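(* Suppose that the atomic Markov chain $X$, with accessible atom $A$ and initial probability distribution $\nu$, is $\beta$-regular with $\beta\in(0,1)$. If $(k_n)$ is a sequence of real numbers such that $k_n\to+\infty$ and $(\ln n)\exp(k_n\beta)/n=o(L_A(\exp(k_n)))$ as $n\to+\infty$, then $$\widehat\beta_{N_n}(k_{N_n})\to\beta\quad\mathbb{P}_\nu\text{-almost surely as } n\to+\infty.$$ In particular, for $0<A_0<1$, $\widehat\beta_{N_n}(A_0\ln N_n)\to\beta$ $\mathbb{P}_\nu$-almost surely as $n\to+\infty$.
   Context: $X=(X_n)_{n\in\mathbb{N}}$ is a time-homogeneous, $\psi$-irreducible, aperiodic, Harris recurrent Markov chain on a state space $E$ with countably generated $\sigma$-field $\mathcal{E}$ and transition probability $\Pi$; $\mathbb{P}_\nu$ is the law when $X_0\sim\nu$. An accessible atom is a set $A\in\mathcal{E}$ with $\psi(A)>0$ and $\Pi(x,\cdot)=\Pi(y,\cdot)$ for all $x,y\in A$; $\mathbb{P}_A$ is the law when $X_0\in A$. Let $\tau_A=\tau_A(1)=\inf\{n\geq1: X_n\in A\}$, $\tau_A(j)=\inf\{n>\tau_A(j-1): X_n\in A\}$ for $j\geq2$, and $S_j=\tau_A(j+1)-\tau_A(j)$. $N_n=\max(\sum_{i=1}^n\mathbb{I}\{X_i\in A\}-1,\,0)$ is the number of durations $S_j$ completely observed up to time $n$. For an atomic chain, being $\beta$-regular is equivalent to the existence of a slowly varying function $L_A:\mathbb{R}_+\to\mathbb{R}_+$ (i.e. $L_A(\lambda z)/L_A(z)\to1$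 as $z\to+\infty$ for all $\lambda>0$) with $\mathbb{P}_A(\tau_A\geq m)=L_A(m)m^{-\beta}$ for all integers $m\geq1$. For real $l$, $\widehat p^{(N_n)}_l=\frac1{N_n}\sum_{i=1}^{N_n}\mathbb{I}\{S_i>e^l\}$ (for $N_n\geq 1$, which holds almost surely for $n$ large enough). The estimator is $\widehat\beta_{N_n}(k)=\ln(\widehat p^{(N_n)}_k/\widehat p^{(N_n)}_{k+1})$ when $\widehat p^{(N_n)}_{k+1}>0$ and $0$ otherwise.
   Formalization: The slowly varying function L_A is additionally assumed measurable, as in the usual definition; without this, L_A can be altered arbitrarily at the points exp(k_n) between integers, so the growth condition becomes empty and the claim fails. *)

(* Defs.v *)
From HB Require Import structures.
From mathcomp Require Import all_boot all_order all_algebra.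
From mathcomp Require Import all_classical all_reals all_analysis.

Set Implicit Arguments.
Unset Strict Implicit.
Unset Printing Implicit Defensive.

Import Order.TTheory GRing.Theory Num.Theory.
Import numFieldNormedType.Exports.

Local Open Scope classical_set_scope.
Local Open Scope ring_scope.

Definition countably_generated d (E : measurableType d) : Prop :=
  exists G : nat -> set E, (measurable : set (set E)) = <<s range G >>.

Definition history d d' (E : measurableType d) (T : measurableType d')
    (X : nat -> {mfun T >-> E}) (n : nat) : set (set T) :=
  <<s [set D | exists i (B : set E),
         [/\ (i <= n)%N, measurable B & D = X i @^-1` B]] >>.

(* The second clause says that Pi (X n) B is a version of the conditional
   probability of X n.+1 \in B given sigma(X 0, ..., X n). *)
Definition markov_chain (R : realType) d d' (E : measurableType d)
    (T : measurableType d') (Pi : R.-pker E ~> E) (X : nat -> {mfun T >-> E})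
    (nu : probability E R) (P : probability T R) : Prop :=
  (forall B, measurable B -> P (X 0%N @^-1` B) = nu B) /\
  (forall n D B, history X n D -> measurable B ->
     P (D `&` X n.+1 @^-1` B) = (\int[P]_(w in D) Pi (X n w) B)%E).

(* One process X on one measurable space T, with a law P nu on T for each
   initial distribution nu, as on the canonical path space. *)
Definition markov_family (R : realType) d d' (E : measurableType d)
    (T : measurableType d') (Pi : R.-pker E ~> E) (X : nat -> {mfun T >-> E})
    (P : probability E R -> probability T R) : Prop :=
  forall nu, markov_chain Pi X nu (P nu).

(* The law when the chain starts from the point x. *)
Definition law_at (R : realType) d d' (E : measurableType d)
    (T : measurableType d') (P : probability E R -> probability T R) (x : E) :
    probability T R := P (\d_x : probability E R).

(* The time of the j-th visit to A at a positive time, +oo if there is none;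
   tau X A 0 = 0 makes tau X A 1 the infimum over n >= 1. *)
Fixpoint tau (R : realType) d d' (E : measurableType d) (T : measurableType d')
    (X : nat -> {mfun T >-> E}) (A : set E) (j : nat) (w : T) : \bar R :=
  if j is i.+1 then
    ereal_inf [set n%:R%:E | n in
      [set n : nat | (tau R X A i w < n%:R%:E)%E /\ A (X n w)]]
  else 0%E.

Definition irreducible (R : realType) d d' (E : measurableType d)
    (T : measurableType d') (X : nat -> {mfun T >-> E})
    (P : probability E R -> probability T R)
    (psi : {sigma_finite_measure set E -> \bar R}) : Prop :=
  (0 < psi setT)%E /\
  forall B, measurable B -> (0 < psi B)%E ->
    forall x, (0 < law_at P x [set w | (tau R X B 1 w < +oo)%E])%E.

Definition cyclic_decomposition (R : realType) d (E : measurableType d)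
    (Pi : R.-pker E ~> E) (psi : {sigma_finite_measure set E -> \bar R})
    (p : nat) (D : nat -> set E) : Prop :=
  [/\ (0 < p)%N,
      forall i, (i < p)%N -> measurable (D i),
      trivIset `I_p D,
      psi (~` \bigcup_(i < p) D i) = 0%E &
      forall i x, (i < p)%N -> D i x -> Pi x (D (i.+1 %% p)%N) = 1%E].

(* The period, i.e. the largest length of a cyclic decomposition, is 1;
   i.e. none is longer than the trivial one, of length 1. *)
Definition aperiodic (R : realType) d (E : measurableType d)
    (Pi : R.-pker E ~> E) (psi : {sigma_finite_measure set E -> \bar R}) :
    Prop :=
  forall p D, cyclic_decomposition Pi psi p D -> (p <= 1)%N.

Definition harris_recurrent (R : realType) d d' (E : measurableType d)
    (T : measurableType d') (X : nat -> {mfun T >-> E})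
    (P : probability E R -> probability T R)
    (psi : {sigma_finite_measure set E -> \bar R}) : Prop :=
  forall B, measurable B -> (0 < psi B)%E ->
    forall x, law_at P x (lim_sup_set (fun n => X n @^-1` B)) = 1%E.

Definition accessible_atom (R : realType) d (E : measurableType d)
    (Pi : R.-pker E ~> E) (psi : {sigma_finite_measure set E -> \bar R})
    (A : set E) : Prop :=
  [/\ measurable A, (0 < psi A)%E &
      forall x y, A x -> A y ->
        forall B, measurable B -> Pi x B = Pi y B].

(* Measurability belongs to the usual definition (Karamata theory); without it
   slow variation does not control L between the integers. *)
Definition slowly_varying (R : realType) (L : R -> R) : Prop :=
  [/\ measurable_fun (`[0, +oo[ : set R) L,
      forall z, 0 <= z -> 0 <= L z &
      forall l, 0 < l -> L (l * z) / L z @[z --> +oo] --> (1 : R)].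

(* For an atomic chain, beta-regularity means that some such L exists. By the
   atom property the law of tau X A 1 is the same from every point of A; this
   is its law under P_A. *)
Definition regular_chain (R : realType) d d' (E : measurableType d)
    (T : measurableType d') (X : nat -> {mfun T >-> E})
    (P : probability E R -> probability T R) (A : set E) (beta : R)
    (L : R -> R) : Prop :=
  slowly_varying L /\
  forall m x, (1 <= m)%N -> A x ->
    law_at P x [set w | (m%:R%:E <= tau R X A 1 w)%E] =
    (L m%:R * m%:R `^ (- beta))%:E.

Definition duration (R : realType) d d' (E : measurableType d)
    (T : measurableType d') (X : nat -> {mfun T >-> E}) (A : set E)
    (j : nat) (w : T) : \bar R :=
  (tau R X A j.+1 w - tau R X A j w)%E.

Definition nb_durations d d' (E : measurableType d) (T : measurableType d')
    (X : nat -> {mfun T >-> E}) (A : set E) (n : nat) (w : T) : nat :=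
  ((\sum_(1 <= i < n.+1) (X i w \in A)) - 1)%N.

Definition p_hat (R : realType) d d' (E : measurableType d)
    (T : measurableType d') (X : nat -> {mfun T >-> E}) (A : set E)
    (N : nat) (l : R) (w : T) : R :=
  (\sum_(1 <= i < N.+1) ((expR l)%:E < duration R X A i w)%E%:R) / N%:R.

Definition beta_hat (R : realType) d d' (E : measurableType d)
    (T : measurableType d') (X : nat -> {mfun T >-> E}) (A : set E)
    (N : nat) (k : R) (w : T) : R :=
  if 0 < p_hat X A N (k + 1) w
  then ln (p_hat X A N k w / p_hat X A N (k + 1) w) else 0.

(* Main.v *)
Require Import Defs.
From HB Require Import structures.
From mathcomp Require Import all_boot all_order all_algebra.
From mathcomp Require Import all_classical all_reals all_analysis.
From mathcomp Require Import measurable_realfun zify ring lra.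
Import Order.TTheory GRing.Theory Num.Theory.
Import numFieldNormedType.Exports.

Set Implicit Arguments.
Unset Strict Implicit.
Unset Printing Implicit Defensive.

Local Open Scope classical_set_scope.
Local Open Scope ring_scope.

(** Regeneration turns the estimator into a quotient of two binomial
frequencies. By the atom property, what happens after a visit to [A] does not
depend on the past of the chain, so for each fixed [s] the events
[S_j > s], [j >= 1], are independent and have the common probability
[F s = P_A (tau_A > s)] ([bernoulli_trials_long_duration]). Their number among
the first [n] durations is thus binomial, and the Chernoff bounds give relative
error at least [e] with probability at most [2 exp (- e^2 n F s / 8)]. If
[n F (s_n)] dominates [ln n], this is eventually below [2 / n^2], and
Borel-Cantelli makes the relative error vanish almost surely, although the level
[s_n] moves with [n] ([ae_nb_occ_ratio_cvg1]). Applied to the levels [exp (k n)]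
and [exp (k n + 1)], it reduces the limit of the estimator to the deterministic
limit of [F (exp (k n)) / F (exp (k n + 1))], which is [exp beta] by regular
variation ([cvg_tail_ratio], [ae_beta_hat_cvg]). Finally the number of completed
durations tends to infinity almost surely ([nb_durations_dvg]), so the limit
persists along it.

Three points need work.

- Measurability and the Markov property are available through the sigma-fields
  [history X n] only. Everything about durations is therefore expressed by the
  counting process [visits X A] ([duration_gt]), which turns an event about a
  duration started by a visit at time [n] into the absence of visits from
  [n + 1] to [n + s]; the probability of the latter given the history is
  computed by iterating the kernel outside [A] ([prob_avoid]).

- The law started from [nu] is tied to the laws started from points through
  these iterated kernels alone: Harris recurrence gives
  [P_x (no visit up to m) -> 0] for each [x], and dominated convergence
  under [nu] transfers it ([prob_no_visit0_cvg0]).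

- The tail is described by [L] at integers, whereas the hypothesis on [k]
  involves [L] at the real points [exp (k n)]. The two are compared by
  [slowly_varying_ratio], the instance of the uniform convergence theorem for
  slowly varying functions that measurability of [L] provides.

For [k n = A0 ln n] the growth condition holds because [beta < 1] makes the
product of the argument and the tail eventually nondecreasing along powers of
two, whence [F s >= c / (s + 1)] for large [s] ([tail_ge_inv]), and [n F (n^A0)]
is at least of the order of [n^(1 - A0)]. *)

(** * Visits to a set and the durations between them *)

Section visits.
Context (R : realType) (d d' : measure_display) (E : measurableType d)
  (T : measurableType d').
Implicit Types (X : nat -> {mfun T >-> E}) (A : set E).

Definition visits X A (n : nat) (w : T) : nat :=
  (\sum_(1 <= i < n.+1) (X i w \in A))%N.

Lemma visits0 X A w : visits X A 0 w = 0%N.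
Proof. by rewrite /visits big_geq. Qed.

Lemma visitsS X A n w :
  visits X A n.+1 w = (visits X A n w + (X n.+1 w \in A))%N.
Proof. by rewrite /visits big_nat_recr. Qed.

Lemma leq_visits X A w : {homo (fun n => visits X A n w) : m n / (m <= n)%N}.
Proof.
apply: homo_leq => // [|n]; first exact: leq_trans.
by rewrite visitsS leq_addr.
Qed.

(** The counting process has unit jumps, so it does not skip a level. *)
Lemma visits_gt_exists X A w j n : (j < visits X A n w)%N ->
  exists m, [/\ (0 < m <= n)%N, X m w \in A & visits X A m w = j.+1].
Proof.
elim: n => [|n IH]; first by rewrite visits0.
have [/IH[m [/andP[m0 mn] Xm vm]] _|vn] := ltnP j (visits X A n w).
  by exists m; split => //; rewrite m0 ltnW.
move=> jn; exists n.+1; split => //; rewrite ?leqnn//.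
- by move: jn; rewrite visitsS; case: (_ \in _) => //; lia.
- by move: jn; rewrite visitsS; case: (_ \in _) => /=; lia.
Qed.

Lemma tau_nat X A j w :
  tau R X A j w = +oo%E \/ exists n : nat, tau R X A j w = n%:R%:E.
Proof.
case: j => [|j] /=; first by right; exists 0%N.
set S := [set n : nat | _].
have [[n0 Sn0]|S0] := pselect (exists n, S n); last first.
  left; rewrite (_ : S = set0) ?image_set0 ?ereal_inf0//.
  by apply/seteqP; split => // x Sx; case: S0; exists x.
right.
have ex : exists n, `[< S n >] by exists n0; apply/asboolP.
case: (ex_minnP ex) => m /asboolP Sm mmin; exists m.
apply/eqP; rewrite eq_le; apply/andP; split.
  by apply: ereal_inf_lbound; exists m.
apply: le_ereal_inf_tmp => _ [k Sk <-]; rewrite lee_fin ler_nat mmin//.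
exact/asboolP.
Qed.

(** The passage between the hitting times, defined by infima in the extended
reals, and the counting process, which depends on finitely many coordinates:
the infimum over a set of naturals is attained. *)
Lemma tau_le X A j n w :
  (tau R X A j w <= n%:R%:E)%E = (j <= visits X A n w)%N.
Proof.
elim: j n => [|j IH] n; first by rewrite /= lee_fin ler0n.
have ltE (m : nat) : (tau R X A j w < m.+1%:R%:E)%E = (j <= visits X A m w)%N.
  rewrite -IH; have [->|[k ->]] := tau_nat X A j w; first by rewrite leye_eq.
  by rewrite lte_fin lee_fin ltr_nat ler_nat ltnS.
apply/idP/idP => [|/visits_gt_exists[m [/andP[m0 mn] Xm vm]]]; last first.
  apply: (@le_trans _ _ m%:R%:E); last by rewrite lee_fin ler_nat.
  apply: ereal_inf_lbound; exists m => //; split; last exact/set_mem.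
  move: m m0 {mn} Xm vm => [//|m] _ Xm vm; rewrite ltE.
  by move: vm; rewrite visitsS Xm; lia.
move=> tn; rewrite leqNgt; apply/negP => vn.
suff: ((n.+1)%:R%:E <= tau R X A j.+1 w)%E.
  by move=> /le_trans/(_ tn); rewrite lee_fin ler_nat ltnn.
apply: le_ereal_inf_tmp => _ [m [/[swap] Xm tm0] <-].
have {tm0} tm : (tau R X A j w < m%:R%:E)%E by [].
rewrite lee_fin ler_nat ltnNge.
apply/negP => mn; case: m tm Xm mn => [|m].
  have [->//|[k ->]] := tau_nat X A j w.
  by rewrite lte_fin ltrn0.
rewrite ltE => jm /mem_set Xm mn.
by have := leq_visits X A w mn; rewrite visitsS Xm; lia.
Qed.

(** A duration is a difference of extended reals, which is -oo when both times
are infinite, so the [j]-th visit has to occur, say at time [n]; as visits take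
place at integer times, only the integer part of [s] matters. *)
Lemma duration_gt X A j w (s : R) : 0 <= s -> (0 < j)%N ->
  (s%:E < duration R X A j w)%E <->
  exists n, [/\ (0 < n)%N, X n w \in A, visits X A n w = j &
                visits X A (n + Num.truncn s) w = j].
Proof.
move=> s0 j0.
have tgt m : ((m%:R%:E < tau R X A j.+1 w)%E = (visits X A m w <= j)%N).
  by rewrite ltNge tau_le -ltnNge ltnS.
have gtE n : (s%:E < tau R X A j.+1 w - n%:R%:E)%E =
             (visits X A (n + Num.truncn s) w <= j)%N.
  rewrite -tgt; have [->|[k ->]] := tau_nat X A j.+1 w.
    by rewrite !ltry.
  rewrite -EFinB !lte_fin ltr_nat ltrBrDl.
  have /andP[ts st] := truncn_itv s0.
  apply/idP/idP => [nsk|].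
    by rewrite -(ltr_nat R) natrD (le_lt_trans _ nsk)// lerD2l.
  rewrite -addnS => nk.
  rewrite (@lt_le_trans _ _ (n + (Num.truncn s).+1)%:R)// ?ler_nat//.
  by rewrite natrD ltrD2l.
rewrite /duration; split.
  have [->|[n tn]] := tau_nat X A j w.
    by rewrite addeNy ltNge leNye.
  rewrite tn gtE => vj.
  have jv : (j <= visits X A n w)%N by rewrite -tau_le tn.
  have vn : visits X A n w = j.
    apply/eqP; rewrite eqn_leq jv andbT (leq_trans _ vj)//.
    by rewrite leq_visits// leq_addr.
  have [m [/andP[m0 mn] Xm vm]] : exists m,
      [/\ (0 < m <= n)%N, X m w \in A & visits X A m w = j].
    by case: j j0 jv {tgt gtE tn vj vn} => // j _ /visits_gt_exists.
  have mE : m = n.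
    apply/eqP; rewrite eqn_leq mn -(ler_nat R) -lee_fin -tn tau_le.
    by rewrite vm leqnn.
  exists n; split => //; rewrite -?mE// mE.
  apply/eqP; rewrite eqn_leq vj/= -[X in (X <= _)%N]vn.
  by rewrite leq_visits// leq_addr.
move=> [n [n0 Xn vn vns]].
suff -> : tau R X A j w = n%:R%:E by rewrite gtE vns.
have := tau_le X A j n w; rewrite vn leqnn.
have [->|[k tk]] := tau_nat X A j w; first by rewrite leye_eq.
rewrite tk lee_fin ler_nat => kn; congr (_%:R%:E).
apply/eqP; rewrite eqn_leq kn/= leqNgt; apply/negP => kn'.
have : (j <= visits X A k w)%N by rewrite -tau_le tk.
have /(leq_visits X A w) : (k <= n.-1)%N by lia.
case: n n0 Xn vn {vns kn kn'} => // n _ Xn; rewrite visitsS Xn /=; lia.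
Qed.

End visits.

(** * One step of the chain and its histories *)

Section const_kernel.
Context (R : realType) (d d' : measure_display) (E : measurableType d)
  (T : measurableType d') (m : {finite_measure set E -> \bar R}).

(** Lets composition of kernels act on a plain finite measure. *)
Definition const_kernel of T : {measure set E -> \bar R} := m.

Let measurable_const_kernel U :
  measurable U -> measurable_fun [set: T] (const_kernel ^~ U).
Proof. by move=> _; exact: measurable_cst. Qed.

HB.instance Definition _ :=
  @isKernel.Build _ _ _ _ _ const_kernel measurable_const_kernel.

Let const_kernel_uub : measure_fam_uub const_kernel.
Proof.
exists (fine (m setT) + 1) => /= _.
rewrite EFinD fineK ?fin_num_measure// lteDl// ?lte_fin//.
exact: fin_num_measure.
Qed.

HB.instance Definition _ :=
  @Kernel_isFinite.Build _ _ _ _ _ const_kernel const_kernel_uub.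
End const_kernel.

(** If [m'] is [m] transported by one step of the kernel, this holds for
integrals of functions as well; it is the composition theorem for the constant
kernel [m] followed by [Pi]. *)
Lemma ge0_integral_mixture (R : realType) (d : measure_display)
    (E : measurableType d) (Pi : R.-pker E ~> E)
    (m : {finite_measure set E -> \bar R}) (m' : {measure set E -> \bar R})
    (f : E -> \bar R) :
    (forall B, measurable B -> m' B = \int[m]_x Pi x B)%E ->
    (forall x, 0 <= f x)%E -> measurable_fun setT f ->
  (\int[m']_y f y = \int[m]_x \int[Pi x]_y f y)%E.
Proof.
move=> m'E f0 mf.
pose l : R.-sfker unit ~> E := @const_kernel _ _ _ E unit m.
pose k : R.-sfker (unit * E)%type ~> E :=
  @kernel.kernel_snd _ _ _ unit E E R Pi.
have := @integral_kcomp _ _ _ _ _ _ _ l k tt f f0 mf.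
rewrite /= => <-.
apply: eq_measure_integral => B mB _.
by rewrite m'E.
Qed.

Section history_theory.
Context (d d' : measure_display) (E : measurableType d)
  (T : measurableType d') (X : nat -> {mfun T >-> E}).

(** Names the generators, so that [history] is the sigma-algebra of a type. *)
Definition history_gen n : set (set T) :=
  [set D | exists i (B : set E),
     [/\ (i <= n)%N, measurable B & D = X i @^-1` B]].

Lemma historyE n :
  history X n = @measurable _ (g_sigma_algebraType (history_gen n)).
Proof. by []. Qed.

Lemma history_measurable n D : history X n D -> measurable D.
Proof.
apply: smallest_sub; first exact: sigma_algebra_measurable.
move=> _ [i [B [_ mB ->]]]; rewrite -[_ @^-1` _]setTI.
exact: measurable_funP.
Qed.

Lemma history_le m n : (m <= n)%N -> history X m `<=` history X n.
Proof.
move=> mn; apply: sub_sigma_algebra2 => _ [i [B [im mB ->]]].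
by exists i, B; split => //; exact: leq_trans mn.
Qed.

Lemma history_preimage n i (B : set E) : (i <= n)%N -> measurable B ->
  history X n (X i @^-1` B).
Proof. by move=> ni mB; apply: sub_sigma_algebra; exists i, B. Qed.

(** An event decided by the pattern of visits to [A] up to time [n] is the union
of the finitely many patterns that it allows. It is used for every event of the
past below, as it avoids any computation with unions and intersections. *)
Lemma history_of_indicators (A : set E) n (D : set T) : measurable A ->
    (forall w w', (forall i, (i <= n)%N -> (X i w \in A) = (X i w' \in A)) ->
       D w -> D w') ->
  history X n D.
Proof.
move=> mA Dinv.
pose pat w : {ffun 'I_n.+1 -> bool} := [ffun i : 'I_n.+1 => X i w \in A].
have -> : D = \bigcup_(b in [set b | exists2 w, D w & pat w = b])
    \bigcap_(i : 'I_n.+1) (X i @^-1` (if b i then A else ~` A)).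
  apply/seteqP; split => [w Dw|w [b [w' Dw' bE] bw]].
    exists (pat w); first by exists w.
    move=> i _; rewrite /= ffunE.
    by case: ifPn => [/set_mem//|/negP + /mem_set].
  apply: (Dinv w') => // i ni; have := bw (Ordinal (ni : (i < n.+1)%N)) I.
  rewrite -bE ffunE /=; case: ifPn => [_ /mem_set -> //|_ /= nXi].
  by rewrite memNset.
rewrite historyE; apply: fin_bigcup_measurable => // b _.
apply: fin_bigcap_measurable => // i _; rewrite -historyE.
apply: history_preimage; first by rewrite -ltnS.
by case: ifP => // _; exact: measurableC.
Qed.
End history_theory.

Section restricted_law.
Context (R : realType) (d d' : measure_display) (E : measurableType d)
  (T : measurableType d') (P : probability T R) (Y : {mfun T >-> E})
  (D : set T).

(** The law of [Y] on the event [D], without normalization; measurability of [D]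
is an argument because the measure structure depends on it. *)
Definition restricted_law of measurable D :=
  fun B : set E => P (D `&` Y @^-1` B).

Variable mD : measurable D.
Local Notation law := (restricted_law mD).

Let mY B : measurable B -> measurable (Y @^-1` B).
Proof. by move=> mB; rewrite -[_ @^-1` _]setTI; exact: measurable_funP. Qed.

Let restricted_lawE B :
  law B = pushforward (mrestr P mD) Y B.
Proof. by rewrite /pushforward /mrestr/= setIC. Qed.

Let restricted_law0 : law set0 = 0%E.
Proof. by rewrite /restricted_law preimage_set0 setI0 measure0. Qed.

Let restricted_law_ge0 B : (0 <= law B)%E.
Proof. exact: measure_ge0. Qed.

Let restricted_law_sigma_additive : semi_sigma_additive law.
Proof.
rewrite (_ : law = pushforward (mrestr P mD) Y); last first.
  by apply/funext => B; rewrite restricted_lawE.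
exact: measure_semi_sigma_additive.
Qed.

HB.instance Definition _ := isMeasure.Build _ _ _ law
  restricted_law0 restricted_law_ge0 restricted_law_sigma_additive.

Let restricted_law_fin : fin_num_fun law.
Proof.
move=> B mB; rewrite /restricted_law fin_num_measure//.
by apply: measurableI => //; exact: mY.
Qed.

HB.instance Definition _ :=
  Measure_isFinite.Build _ _ _ law restricted_law_fin.

Lemma integral_restricted_law f : (forall y, 0 <= f y)%E ->
    measurable_fun setT f ->
  (\int[law]_y f y = \int[P]_(w in D) f (Y w))%E.
Proof.
move=> f0 mf.
transitivity (\int[pushforward (mrestr P mD) Y]_y f y)%E.
  by apply: eq_measure_integral => B mB _; exact: restricted_lawE.
rewrite ge0_integral_pushforward//= ?preimage_setT.
rewrite (@ge0_negligible_integral _ _ _ (mrestr P mD) setT (~` D))//=.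
- rewrite setTD setCK; apply: eq_measure_integral => B mB BD.
  by rewrite /= /mrestr; congr (P _); exact/setIidPl.
- exact: measurableC.
- exact: measurableT_comp.
- by rewrite /mrestr setICl measure0.
Qed.
End restricted_law.

(** The Markov property is given for events; [restricted_law] turns it into an
identity between measures on the state space, to which
[ge0_integral_mixture] applies. *)
Lemma markov_integral (R : realType) (d d' : measure_display)
    (E : measurableType d) (T : measurableType d') (Pi : R.-pker E ~> E)
    (X : nat -> {mfun T >-> E}) (nu : probability E R) (P : probability T R)
    n (D : set T) (f : E -> \bar R) :
    markov_chain Pi X nu P -> history X n D ->
    (forall y, 0 <= f y)%E -> measurable_fun setT f ->
  (\int[P]_(w in D) f (X n.+1 w) =
   \int[P]_(w in D) \int[Pi (X n w)]_y f y)%E.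
Proof.
move=> [_ mk] hD f0 mf; have mD := history_measurable hD.
rewrite -(integral_restricted_law P (X n.+1) mD)//.
rewrite -(@integral_restricted_law _ _ _ _ _ P (X n) _ mD
  (fun x => \int[Pi x]_y f y)%E).
- have lawE B : measurable B -> restricted_law P (X n.+1) mD B =
      (\int[restricted_law P (X n) mD]_x Pi x B)%E.
    move=> mB; rewrite integral_restricted_law//; first exact: mk.
    exact: measurable_kernel.
  have := (@ge0_integral_mixture _ _ _ Pi
    (restricted_law P (X n) mD) (restricted_law P (X n.+1) mD) f lawE f0 mf).
  exact.
- by move=> x; exact: integral_ge0.
- apply: measurable_fun_integral_kernel => //; exact: measurable_kernel.
Qed.

(** * The probability of avoiding an atom *)

Lemma eq_visits (d d' : measure_display) (E : measurableType d)
    (T : measurableType d') (X : nat -> {mfun T >-> E}) (A : set E) n w w' :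
    (forall i, (i <= n)%N -> (X i w \in A) = (X i w' \in A)) ->
  forall k, (k <= n)%N -> visits X A k w = visits X A k w'.
Proof.
move=> ww' k kn; apply: eq_big_nat => i /andP[_ ik]; rewrite ww'//.
by rewrite (leq_trans _ kn)// -ltnS.
Qed.

Section avoid.
Context (R : realType) (d : measure_display) (E : measurableType d)
  (Pi : R.-pker E ~> E) (A : set E).
Hypothesis mA : measurable A.

(** This is the probability, for the chain started at [x], of no visit to [A] at
the times [1], ..., [m]; see [law_at_no_visit0]. *)
Fixpoint avoid (m : nat) (x : E) : \bar R :=
  if m is m'.+1 then \int[Pi x]_(y in ~` A) avoid m' y else 1%E.

Lemma avoid_ge0 m x : (0 <= avoid m x)%E.
Proof. by elim: m x => [|m IH] x //=; apply: integral_ge0 => y _. Qed.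

Lemma measurable_avoid m : measurable_fun [set: E] (avoid m).
Proof.
elim: m => [|m IH] /=; first exact: measurable_cst.
under eq_fun do rewrite integral_mkcond.
apply: measurable_fun_integral_kernel.
- exact: measurable_kernel.
- by move=> y; rewrite patchE; case: ifP => // _; exact: avoid_ge0.
- apply/(measurable_restrictT _ _).1 => //; first exact: measurableC.
  exact: measurable_funTS.
Qed.

(** Induction on [m] with the history growing: the first of the [m.+1] avoided
visits is absorbed into [D], and the Markov property exchanges the remaining
probability at time [n.+1] for its average at time [n]. *)
Lemma prob_avoid (d' : measure_display) (T : measurableType d')
    (X : nat -> {mfun T >-> E}) (nu : probability E R) (P : probability T R)
    n m (D : set T) :
    markov_chain Pi X nu P -> history X n D ->
  P (D `&` [set w | visits X A (n + m) w = visits X A n w]) =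
  (\int[P]_(w in D) avoid m (X n w))%E.
Proof.
move=> hX; elim: m n D => [|m IH] n D hD.
  rewrite addn0 (_ : [set w | _] = setT) ?setIT; last by apply/seteqP; split.
  rewrite /= integral_cst ?mul1e//; exact: history_measurable hD.
pose D' := D `&` X n.+1 @^-1` (~` A).
have hD' : history X n.+1 D'.
  rewrite historyE; apply: measurableI; rewrite -historyE.
    exact: history_le hD.
  by apply: history_preimage => //; exact: measurableC.
transitivity (P (D' `&` [set w | visits X A (n.+1 + m) w = visits X A n.+1 w])).
  congr (P _); rewrite /D' addSnnS; apply/seteqP; split => w /=.
    move=> [Dw vw]; have := leq_visits X A w (leq_addr m n.+1).
    rewrite addSnnS vw visitsS; case: (boolP (_ \in _)) => [_|/negP Xn _].
      by rewrite addn1 ltnn.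
    by rewrite addn0; split => //; split => //= /mem_set.
  by move=> [[Dw nXn] ->]; rewrite visitsS memNset// addn0.
rewrite IH// /D' integral_mkcondr.
transitivity (\int[P]_(w in D) ((avoid m \_ (~` A)) (X n.+1 w)))%E.
  by apply: eq_integral => w _; rewrite !patchE; congr (if _ then _ else _).
rewrite (markov_integral hX hD).
- by apply: eq_integral => w _; rewrite /= [RHS]integral_mkcond.
- by move=> y; rewrite patchE; case: ifP => // _; exact: avoid_ge0.
- apply/(measurable_restrictT _ _).1 => //; first exact: measurableC.
  by apply: measurable_funTS; exact: measurable_avoid.
Qed.
End avoid.

Section recurrence.
Context (R : realType) (d d' : measure_display) (E : measurableType d)
  (T : measurableType d') (Pi : R.-pker E ~> E) (X : nat -> {mfun T >-> E})
  (P : probability E R -> probability T R) (A : set E).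
Hypotheses (hX : markov_family Pi X P) (mA : measurable A).

Definition no_visit n m : set T :=
  [set w | visits X A (n + m) w = visits X A n w].

Lemma history_no_visit n m : history X (n + m) (no_visit n m).
Proof.
apply: (@history_of_indicators _ _ _ _ _ A) => // w w' ww'.
by rewrite /no_visit/= !(eq_visits ww')// leq_addr.
Qed.

Lemma measurable_no_visit n m : measurable (no_visit n m).
Proof. exact: history_measurable (@history_no_visit n m). Qed.

Lemma nonincreasing_no_visit n : nonincreasing_seq (no_visit n).
Proof.
move=> m m' mm'; apply/subsetPset => w vw; apply/eqP.
rewrite eqn_leq -[X in (_ <= X)%N && _]vw.
by rewrite !leq_visits ?leq_add2l ?leq_addr.
Qed.

Lemma integral_initial (nu : probability E R) f : (forall x, 0 <= f x)%E ->
    measurable_fun setT f ->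
  (\int[P nu]_w f (X 0 w) = \int[nu]_x f x)%E.
Proof.
move=> f0 mf; rewrite -(integral_restricted_law (P nu) (X 0%N) measurableT)//.
apply: eq_measure_integral => B mB _; have [h0 _] := hX nu.
rewrite /= /restricted_law setTI; exact: h0.
Qed.

Lemma prob_no_visit0 nu m :
  P nu (no_visit 0 m) = (\int[nu]_x avoid Pi A m x)%E.
Proof.
rewrite -(integral_initial nu (avoid_ge0 Pi A m) (measurable_avoid Pi mA m)).
rewrite -(prob_avoid mA m (hX nu)) ?setTI// historyE; exact: measurableT.
Qed.

(** Since the initial law is the Dirac mass at [x], the integral is a value. *)
Lemma law_at_no_visit0 x m : law_at P x (no_visit 0 m) = avoid Pi A m x.
Proof.
rewrite /law_at prob_no_visit0.
have := @integral_dirac d E x R setT measurableT _ (measurable_avoid Pi mA m).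
by rewrite diracT mul1e => <-.
Qed.

Hypothesis atom : forall x y, A x -> A y ->
  forall B, measurable B -> Pi x B = Pi y B.

Lemma avoid_atom m x y : A x -> A y -> avoid Pi A m x = avoid Pi A m y.
Proof.
move=> Ax Ay; case: m => //= m; apply: eq_measure_integral => B mB _.
exact: atom.
Qed.

(** Regeneration: after a visit to the atom the probability of a long absence no
longer depends on the state, hence is independent of the past. *)
Lemma prob_no_visit_atom nu n m D x : A x -> history X n D ->
    D `<=` X n @^-1` A ->
  P nu (D `&` no_visit n m) = (P nu D * avoid Pi A m x)%E.
Proof.
move=> Ax hD DA; rewrite (prob_avoid mA m (hX nu))//.
rewrite (eq_integral (cst (avoid Pi A m x))); last first.
  by move=> w /set_mem/DA Xw; exact: avoid_atom.
rewrite integral_cst; first exact: muleC.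
exact: history_measurable hD.
Qed.

Hypothesis harris :
  forall x, law_at P x (lim_sup_set (fun n => X n @^-1` A)) = 1%E.

Lemma no_visit_cvg0 (Q : probability T R) n (D : set T) : measurable D ->
    Q (\bigcap_m (D `&` no_visit n m)) = 0%E ->
  Q (D `&` no_visit n m) @[m --> \oo] --> 0%E.
Proof.
move=> mD <-; apply: nonincreasing_cvg_mu.
- rewrite (le_lt_trans (probability_le1 _ _)) ?ltry//.
  by apply: measurableI => //; exact: measurable_no_visit.
- by move=> m; apply: measurableI => //; exact: measurable_no_visit.
- apply: bigcap_measurable => // m _.
  by apply: measurableI => //; exact: measurable_no_visit.
- move=> m m' mm'; apply/subsetPset; apply: setIS; apply/subsetPset.
  exact: nonincreasing_no_visit.
Qed.

(** Avoiding [A] forever is incompatible with infinitely many visits, an event of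
full probability. *)
Lemma avoid_cvg0 x : avoid Pi A m x @[m --> \oo] --> 0%E.
Proof.
under eq_fun do rewrite -law_at_no_visit0 -[no_visit _ _]setTI.
apply: no_visit_cvg0 => //.
pose S := lim_sup_set (fun n => X n @^-1` A); have mS : measurable S.
  apply: bigcap_measurable => // k _; apply: bigcup_measurable => j _.
  by rewrite -[_ @^-1` _]setTI; exact: measurable_funP.
apply: (@subset_measure0 _ _ _ _ _ (~` S)).
- apply: bigcap_measurable => // m _; rewrite setTI.
  exact: measurable_no_visit.
- exact: measurableC.
- move=> w vw /(_ 1%N I)[k /= k1 Xk].
  have [_] := vw k I; rewrite /no_visit/= add0n visits0.
  case: k k1 Xk => // k _ Xk.
  by rewrite visitsS mem_set// addn1.
- by have := probability_setC (law_at P x) mS; rewrite harris subee.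
Qed.

(** Harris recurrence speaks of the chain started at a point; the integral
representation and dominated convergence carry it to any initial law. *)
Lemma prob_no_visit0_cvg0 nu : P nu (no_visit 0 m) @[m --> \oo] --> 0%E.
Proof.
under eq_fun do rewrite prob_no_visit0.
have av1 m x : (avoid Pi A m x <= 1)%E.
  rewrite -law_at_no_visit0; apply: probability_le1.
  exact: measurable_no_visit.
rewrite -(integral0 nu setT).
apply: (@dominated_cvg _ _ _ _ _ _ _ _ (cst 1%E)) => //.
- by move=> m; exact: measurable_avoid.
- by move=> x _; exact: avoid_cvg0.
- exact: finite_measure_integrable_cst.
- by move=> m x _; rewrite gee0_abs ?avoid_ge0.
Qed.

(** If the number of visits stays bounded, then either there is no visit, or
there is a last one, at some time [n]. Each of these countably many events is
null, the latter because of regeneration at time [n]. *)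
Lemma ae_visits_dvg nu x : A x ->
  {ae P nu, forall w, visits X A n w @[n --> \oo] --> \oo}.
Proof.
move=> Ax.
have neg0 D n : measurable D ->
    P nu (D `&` no_visit n m) @[m --> \oo] --> 0%E ->
    (P nu).-negligible (\bigcap_m (D `&` no_visit n m)).
  move=> mD cv0; have mI : measurable (\bigcap_m (D `&` no_visit n m)).
    apply: bigcap_measurable => // m _.
    by apply: measurableI => //; exact: measurable_no_visit.
  apply/negligibleP => //; apply/eqP; rewrite eq_le measure_ge0 andbT.
  rewrite -(cvg_lim _ cv0)//; apply: lime_ge; first by apply/cvg_ex; exists 0%E.
  apply: nearW => m; apply: le_measure; rewrite ?inE//.
    by apply: measurableI => //; exact: measurable_no_visit.
  exact: bigcap_inf.
have mXA n : measurable (X n @^-1` A).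
  by rewrite -[_ @^-1` _]setTI; exact: measurable_funP.
pose N := (\bigcap_m (setT `&` no_visit 0 m)) `|`
  \bigcup_n (\bigcap_m ((X n @^-1` A) `&` no_visit n m)).
apply: (@negligibleS _ _ _ _ N).
  move=> w; apply: contra_notP => nN; apply/cvgnyPge => K.
  apply: contrapT => nK.
  have vK n : (visits X A n w <= K)%N.
    rewrite leqNgt; apply/negP => Kn; apply: nK; exists n => // k /= nk.
    by rewrite (leq_trans (ltnW Kn))// leq_visits.
  have ex : exists j, `[< exists n, visits X A n w = j >].
    by exists (visits X A 0 w); apply/asboolP; exists 0%N.
  have bd j : `[< exists n, visits X A n w = j >] -> (j <= K)%N.
    by move=> /asboolP[n <-].
  (* The last visit is the one at which the largest count is reached. *)
  case: (ex_maxnP ex bd) => j /asboolP[n vn] jmax; apply: nN.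
  have vj k : (visits X A k w <= j)%N by apply: jmax; apply/asboolP; exists k.
  case: j vn jmax vj => [|j] vn jmax vj.
    left => m _; split => //; rewrite /no_visit/= visits0.
    by apply/eqP; rewrite -leqn0.
  have [k [_ Xk vk]] : exists m,
      [/\ (0 < m <= n)%N, X m w \in A & visits X A m w = j.+1].
    by apply: visits_gt_exists; rewrite vn.
  right; exists k => // m _; split; first exact/set_mem.
  by apply/eqP; rewrite eqn_leq [X in _ && X]leq_visits ?leq_addr// vk vj.
apply: negligibleU.
  apply: neg0 => //; under eq_fun do rewrite setTI.
  exact: prob_no_visit0_cvg0.
apply: negligible_bigcup => n; apply: neg0 => //.
have hXA := history_preimage (X:=X) (leqnn n) mA.
under eq_fun do rewrite (prob_no_visit_atom nu _ Ax hXA)//.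
have := cvgeZl (fin_num_measure (P nu) _ (mXA n)) (avoid_cvg0 x).
by rewrite mule0.
Qed.

End recurrence.

(** * Chernoff bounds for Bernoulli trials *)

(** From [exp (- x) >= 1 - x] and [(1 + x + 2 x^2) (1 - x) >= 1]. *)
Lemma expR_le_quadratic (R : realType) (x : R) : `|x| <= 2^-1 ->
  expR x <= 1 + x + 2 * x ^+ 2.
Proof.
rewrite ler_norml => /andP[x1 x2].
have x3 : 0 < 1 - x by lra.
rewrite -[x in expR x]opprK expRN -[leLHS]mul1r ler_pdivrMr ?expR_gt0//.
apply: le_trans (_ : (1 + x + 2 * x ^+ 2) * (1 - x) <= _).
  have -> : (1 + x + 2 * x ^+ 2) * (1 - x) = 1 + x ^+ 2 * (1 - 2 * x) by ring.
  by rewrite lerDl mulr_ge0 ?sqr_ge0//; lra.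
rewrite ler_wpM2l ?expR_ge1Dx//.
by have := sqr_ge0 x; nra.
Qed.

Section chernoff.
Context (R : realType) (d : measure_display) (T : measurableType d)
  (P : probability T R).
Implicit Types (B : nat -> set T) (p t a : R).

Definition nb_occ B N w : nat := (\sum_(0 <= i < N) (w \in B i))%N.

(** The next trial is independent of the number of past occurrences, which
determines the law of that number by induction. *)
Definition bernoulli_trials B p :=
  (forall N, measurable (B N)) /\
  forall N (Q : set nat),
    P ([set w | Q (nb_occ B N w)] `&` B N) =
    (P [set w | Q (nb_occ B N w)] * p%:E)%E.

Lemma nb_occ0 B w : nb_occ B 0 w = 0%N.
Proof. by rewrite /nb_occ big_geq. Qed.

Lemma nb_occS B N w : nb_occ B N.+1 w = (nb_occ B N w + (w \in B N))%N.
Proof. by rewrite /nb_occ big_nat_recr. Qed.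

Lemma nb_occS_split B N (Q : set nat) :
  [set w | Q (nb_occ B N.+1 w)] =
    ([set w | Q (nb_occ B N w).+1] `&` B N) `|`
    ([set w | Q (nb_occ B N w)] `&` ~` B N).
Proof.
apply/seteqP; split => w /=; rewrite nb_occS.
  have [/set_mem Bw|/negP Bw] := boolP (w \in B N).
    by rewrite addn1; left.
  by rewrite addn0; right; split => // /mem_set.
move=> [[Qw /mem_set ->]|[Qw]]; first by rewrite addn1.
by move=> nBw; rewrite memNset// addn0.
Qed.

Lemma measurable_nb_occ B N (Q : set nat) : (forall i, measurable (B i)) ->
  measurable [set w | Q (nb_occ B N w)].
Proof.
move=> mB; elim: N Q => [|N IH] Q.
  have [Q0|Q0] := pselect (Q 0%N).
    rewrite (_ : [set w | _] = setT)//; apply/seteqP; split => // w _ /=.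
    by rewrite nb_occ0.
  rewrite (_ : [set w | _] = set0)//; apply/seteqP; split => // w /=.
  by rewrite nb_occ0.
rewrite nb_occS_split; apply: measurableU; apply: measurableI => //.
  exact: (IH (fun n => Q n.+1)).
exact: measurableC.
Qed.

Lemma nb_occC B N w : (nb_occ (fun i => ~` B i) N w + nb_occ B N w = N)%N.
Proof.
elim: N => [|N IH]; first by rewrite !nb_occ0.
rewrite !nb_occS -[in RHS]IH in_setC; case: (_ \in _) => /=; lia.
Qed.

Lemma subn_nb_occ B N w : (N - nb_occ B N w)%N = nb_occ (fun i => ~` B i) N w.
Proof. by rewrite -[X in (X - _)%N](nb_occC B N w) addnK. Qed.

Lemma subn_nb_occC B N w : (N - nb_occ (fun i => ~` B i) N w)%N = nb_occ B N w.
Proof. by rewrite -[X in (X - _)%N](nb_occC B N w) addKn. Qed.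

(** Lower tails are upper tails of the complementary trials. *)
Lemma bernoulli_trialsC B p : bernoulli_trials B p ->
  bernoulli_trials (fun i => ~` B i) (1 - p).
Proof.
move=> [mB iB]; split => [N|N Q]; first exact: measurableC.
have -> : [set w | Q (nb_occ (fun i => ~` B i) N w)] =
          [set w | Q (N - nb_occ B N w)%N].
  by apply/seteqP; split => w /=; rewrite subn_nb_occ.
set Q' : set nat := fun n => Q (N - n)%N.
have mQ := @measurable_nb_occ B N Q' mB.
rewrite -setDE measureD//; last first.
  by rewrite (le_lt_trans (probability_le1 _ _)) ?ltry.
rewrite -[[set w | Q _]]/[set w | Q' (nb_occ B N w)] [X in (_ - X)%E](iB N Q').
rewrite EFinB muleBr ?mule1//.
  exact: fin_num_measure.
Qed.

Lemma bernoulli_trials_ge0 B p : bernoulli_trials B p -> 0 <= p.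
Proof.
move=> [mB /(_ 0%N setT)].
rewrite (_ : [set w | _] = setT); last by apply/seteqP; split.
by rewrite setTI probability_setT mul1e -lee_fin => <-.
Qed.

(** Markov's inequality for the exponential moment, obtained by induction on the
number of trials directly for the tail: conditioning on the last trial gives the
same recursion as the one of the right-hand side. *)
Lemma prob_nb_occ_ge B p t N a : 0 <= t -> bernoulli_trials B p ->
  (P [set w | a <= (nb_occ B N w)%:R]%R <=
   (expR (- (t * a)) * (1 + p * (expR t - 1)) ^+ N)%:E)%E.
Proof.
move=> t0 trB; have [mB iB] := trB; have [mBC iBC] := bernoulli_trialsC trB.
have p0 := bernoulli_trials_ge0 trB.
have p1 := bernoulli_trials_ge0 (bernoulli_trialsC trB).
have mQ n (Q : set nat) := @measurable_nb_occ B n Q mB.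
elim: N a => [|N IH] a.
  rewrite expr0 mulr1; have [a0|a0] := leP a 0.
    apply: (@le_trans _ _ 1%E).
      exact: (probability_le1 _ (mQ 0%N (fun n => a <= n%:R))).
    by rewrite lee_fin -expR0 ler_expR oppr_ge0 mulr_ge0_le0.
  rewrite (_ : [set w | _] = set0) ?measure0 ?lee_fin ?expR_ge0//.
  apply/seteqP; split => // w /=; rewrite nb_occ0.
  by rewrite leNgt a0.
have := nb_occS_split B N (fun n => a <= n%:R) => /= ->.
have -> : [set w | a <= (nb_occ B N w).+1%:R] =
    [set w | a - 1 <= (nb_occ B N w)%:R].
  by apply/seteqP; split => w /=; rewrite -natr1 lerBlDr.
have iBC' : P ([set w | a <= (nb_occ B N w)%:R] `&` ~` B N) =
   (P [set w | a <= (nb_occ B N w)%:R]%R * (1 - p)%:E)%E.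
  have := iBC N (fun n => a <= (N - n)%:R).
  rewrite (_ : [set w | a <= (N - nb_occ (fun i => ~` B i) N w)%:R] =
    [set w | a <= (nb_occ B N w)%:R])//.
  by apply/seteqP; split => w /=; rewrite subn_nb_occC.
rewrite measureU; first last.
- by apply/seteqP; split => // w [[_ Bw] [_]].
- apply: measurableI => //; exact: (mQ N (fun n => a <= n%:R)).
- apply: measurableI => //; exact: (mQ N (fun n => a - 1 <= n%:R)).
rewrite [X in (_ + X)%E]iBC' [X in (X + _)%E](iB N (fun n => a - 1 <= n%:R)).
apply: le_trans (_ : ((expR (- (t * (a - 1))) *
    (1 + p * (expR t - 1)) ^+ N)%:E * p%:E +
  (expR (- (t * a)) * (1 + p * (expR t - 1)) ^+ N)%:E * (1 - p)%:E <= _)%E).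
  by apply: leeD; apply: lee_wpmul2r; rewrite ?lee_fin//; exact: IH.
rewrite -!EFinM -EFinD lee_fin exprS.
rewrite (_ : - (t * (a - 1)) = - (t * a) + t); last by ring.
by rewrite expRD le_eqVlt; apply/orP; left; apply/eqP; ring.
Qed.

Lemma onePx_expN_le (x : R) N : -1 <= x -> (1 + x) ^+ N <= expR (N%:R * x).
Proof.
move=> x1; rewrite expRM_natl lerXn2r ?nnegrE ?expR_ge0 ?expR_ge1Dx//.
by rewrite -lerBlDl sub0r.
Qed.

(** For [t = e / 4] the quadratic error is half of the linear gain. *)
Lemma chernoff_upper B p (e : R) N : bernoulli_trials B p -> 0 < e <= 1 ->
  (P [set w | (1 + e) * (N%:R * p) <= (nb_occ B N w)%:R]%R <=
   (expR (- (e ^+ 2 / 8 * (N%:R * p))))%:E)%E.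
Proof.
move=> trB /andP[e0 e1]; have p0 := bernoulli_trials_ge0 trB.
have t0 : 0 <= e / 4 by lra.
apply: le_trans (prob_nb_occ_ge N _ t0 trB) _; rewrite lee_fin.
apply: (@le_trans _ _ (expR (- (e / 4 * ((1 + e) * (N%:R * p)))) *
   expR (N%:R * (p * (expR (e / 4) - 1))))).
  rewrite ler_wpM2l ?expR_ge0// onePx_expN_le//.
  have h : 1 <= expR (e / 4) by rewrite -[X in X <= _]expR0 ler_expR.
  by apply: (@le_trans _ _ 0); [rewrite lerN10|rewrite mulr_ge0// subr_ge0].
rewrite -expRD ler_expR.
have E : expR (e / 4) - 1 <= e / 4 + 2 * (e / 4) ^+ 2.
  by rewrite lerBlDl addrA; apply: expR_le_quadratic; rewrite ger0_norm; lra.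
have Np : 0 <= N%:R * p by rewrite mulr_ge0.
have := ler_wpM2l Np E; rewrite !mulrA; nra.
Qed.

(** For the complementary trials the factor [exp t] in
[1 + (1 - p) (exp t - 1) = exp t (1 + p (exp (- t) - 1))] cancels the shift of
the threshold by [N], and the estimate ends as the upper one with [- t]. *)
Lemma chernoff_lower B p (e : R) N : bernoulli_trials B p -> 0 < e <= 1 ->
  (P [set w | (nb_occ B N w)%:R <= (1 - e) * (N%:R * p)]%R <=
   (expR (- (e ^+ 2 / 8 * (N%:R * p))))%:E)%E.
Proof.
move=> trB /andP[e0 e1]; have p0 := bernoulli_trials_ge0 trB.
have p1 := bernoulli_trials_ge0 (bernoulli_trialsC trB).
have t0 : 0 <= e / 4 by lra.
have -> : [set w | (nb_occ B N w)%:R <= (1 - e) * (N%:R * p)] =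
  [set w | N%:R - (1 - e) * (N%:R * p) <= (nb_occ (fun i => ~` B i) N w)%:R].
  apply/seteqP; split => w /=;
    have := congr1 (fun n => n%:R : R) (nb_occC B N w); rewrite natrD; lra.
apply: le_trans (prob_nb_occ_ge N _ t0 (bernoulli_trialsC trB)) _.
rewrite lee_fin.
have E : 1 + (1 - p) * (expR (e / 4) - 1) =
    expR (e / 4) * (1 + p * (expR (- (e / 4)) - 1)).
  by rewrite expRN; field; rewrite gt_eqF ?expR_gt0.
rewrite E exprMn -expRM_natl [leLHS]mulrA -expRD.
apply: (@le_trans _ _
  (expR (- (e / 4 * (N%:R - (1 - e) * (N%:R * p))) + N%:R * (e / 4)) *
   expR (N%:R * (p * (expR (- (e / 4)) - 1))))).
  rewrite ler_wpM2l ?expR_ge0// onePx_expN_le//.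
  by have := expR_gt0 (- (e / 4)); nra.
rewrite -expRD ler_expR.
have {}E : expR (- (e / 4)) - 1 <= - (e / 4) + 2 * (e / 4) ^+ 2.
  rewrite lerBlDl addrA -(sqrrN (e / 4)); apply: expR_le_quadratic.
  by rewrite normrN ger0_norm; lra.
have Np : 0 <= N%:R * p by rewrite mulr_ge0.
have := ler_wpM2l Np E; rewrite !mulrA; nra.
Qed.
End chernoff.

(** * Long durations are Bernoulli trials *)

Section durations.
Context (R : realType) (d d' : measure_display) (E : measurableType d)
  (T : measurableType d') (Pi : R.-pker E ~> E) (X : nat -> {mfun T >-> E})
  (P : probability E R -> probability T R) (A : set E).

Definition visit_at j n : set T :=
  [set w | [/\ (0 < n)%N, X n w \in A & visits X A n w = j]].

Definition long_duration (s j : nat) : set T :=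
  \bigcup_n (visit_at j n `&` no_visit X A n s).

Lemma duration_gtE j w (s : R) : 0 <= s -> (0 < j)%N ->
  (s%:E < duration R X A j w)%E = (w \in long_duration (Num.truncn s) j).
Proof.
move=> s0 j0; apply/idP/idP => [|/set_mem [n _ [[n0 Xn vn] vs]]].
  move/(duration_gt X A w s0 j0) => [n [n0 Xn vn vs]]; apply/mem_set.
  by exists n => //; split => //; rewrite /no_visit/= vs.
by apply/(duration_gt X A w s0 j0); exists n; split => //; rewrite vs.
Qed.

Lemma p_hatE N (l : R) w :
  p_hat X A N l w =
  (nb_occ (fun i => long_duration (Num.truncn (expR l)) i.+1) N w)%:R / N%:R.
Proof.
rewrite /p_hat big_add1 /= /nb_occ natr_sum; congr (_ / _).
by apply: eq_bigr => i _; rewrite duration_gtE ?expR_ge0.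
Qed.

Lemma visit_at_inj j n n' w : visit_at j n w -> visit_at j n' w -> n = n'.
Proof.
wlog nn' : n n' / (n <= n')%N => [h|].
  by case: (leqP n n') => [/h//|/ltnW nn' Vn Vn']; exact/esym/(h _ _ nn').
move=> [_ _ vn] [n0 Xn' vn']; apply/eqP; rewrite eqn_leq nn'/= leqNgt.
apply/negP => lt; case: n' n0 Xn' vn' lt {nn'} => // n' _ Xn' vn'.
rewrite ltnS => /(leq_visits X A w).
by move: vn'; rewrite visitsS Xn' vn; lia.
Qed.

Hypotheses (hX : markov_family Pi X P) (mA : measurable A).

Lemma history_visit_at j n (D : set T) :
    (forall w w', visit_at j n w -> visit_at j n w' ->
       (forall k, (k <= n)%N -> visits X A k w = visits X A k w') ->
       (forall k, (k <= n)%N -> (X k w \in A) = (X k w' \in A)) ->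
       D w -> D w') ->
  history X n (visit_at j n `&` D).
Proof.
move=> hD; apply: (@history_of_indicators _ _ _ _ _ A) => // w w' ww'.
move=> [Vw Dw]; have vv := eq_visits ww'.
have Vw' : visit_at j n w'.
  by case: Vw => n0 Xn vn; split => //; rewrite -?ww' -?vv.
by split => //; exact: (hD w w').
Qed.

Lemma measurable_visit_at j n : measurable (visit_at j n).
Proof.
have h : history X n (visit_at j n `&` setT) by apply: history_visit_at.
by rewrite setIT in h; exact: history_measurable h.
Qed.

Lemma measurable_long_duration s j : measurable (long_duration s j).
Proof.
apply: bigcup_measurable => n _; apply: measurableI.
  exact: measurable_visit_at.
exact: measurable_no_visit.
Qed.

(** Before the [j]-th visit all durations of smaller index are completed, hence
decided by the visits seen so far. *)
Lemma long_duration_past s i j n w w' : (i < j)%N ->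
    visit_at j n w ->
    (forall k, (k <= n)%N -> visits X A k w = visits X A k w') ->
    (forall k, (k <= n)%N -> (X k w \in A) = (X k w' \in A)) ->
  long_duration s i w -> long_duration s i w'.
Proof.
move=> ij [n0 Xn vn] vv ww' [m _ [[m0 Xm vm] vms]].
have msn : (m + s < n)%N.
  rewrite ltnNge; apply/negP => /(leq_visits X A w).
  by move: vms; rewrite /no_visit/= vm vn => ->; rewrite leqNgt ij.
have mn : (m <= n)%N by rewrite (leq_trans _ (ltnW msn))// leq_addr.
exists m => //; split; first by split => //; rewrite -?ww' -?vv.
by rewrite /no_visit/= -!vv// ltnW.
Qed.

Lemma eq_nb_long s N n w w' :
    visit_at N.+1 n w -> visit_at N.+1 n w' ->
    (forall k, (k <= n)%N -> visits X A k w = visits X A k w') ->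
    (forall k, (k <= n)%N -> (X k w \in A) = (X k w' \in A)) ->
  nb_occ (fun i => long_duration s i.+1) N w =
  nb_occ (fun i => long_duration s i.+1) N w'.
Proof.
move=> Vw Vw' vv ww'; apply: eq_big_nat => i /andP[_ iN]; congr nat_of_bool.
have iN1 : (i.+1 < N.+1)%N by [].
apply/idP/idP => /set_mem lw; apply/mem_set.
  exact: (long_duration_past iN1 Vw).
apply: (long_duration_past iN1 Vw') lw => k kn; first by rewrite vv.
by rewrite ww'.
Qed.

Hypothesis atom : forall x y, A x -> A y ->
  forall B, measurable B -> Pi x B = Pi y B.
Hypothesis harris :
  forall x, law_at P x (lim_sup_set (fun n => X n @^-1` A)) = 1%E.

(** Split according to the time [n] of the visit that starts the duration: on
that event the number of earlier long durations belongs to the history at time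
[n], and regeneration gives the factor. The times [n] exhaust the space up to a
null set because the visits never stop. *)
Lemma bernoulli_trials_long_duration nu x s : A x ->
  bernoulli_trials (P nu) (fun i => long_duration s i.+1)
    (fine (avoid Pi A s x)).
Proof.
move=> Ax; split => [N|N Q]; first exact: measurable_long_duration.
set Z := nb_occ _ N.
have mZ : measurable [set w | Q (Z w)].
  by apply: measurable_nb_occ => i; exact: measurable_long_duration.
pose D n : set T := visit_at N.+1 n `&` [set w | Q (Z w)].
have hD n : history X n (D n).
  apply: history_visit_at => w w' Vw Vw' vv ww' /=.
  by rewrite /Z (eq_nb_long _ Vw Vw' vv ww').
have mD n : measurable (D n) := history_measurable (hD n).
have av : avoid Pi A s x \is a fin_num.
  rewrite -(law_at_no_visit0 hX mA); apply: fin_num_measure.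
  exact: measurable_no_visit.
have tD : trivIset setT D.
  apply/trivIsetP => i j _ _ /eqP ij; apply/seteqP; split => // w.
  move=> [[Vi _] [Vj _]]; exact: ij (visit_at_inj Vi Vj).
have -> : [set w | Q (Z w)] `&` long_duration s N.+1 =
    \bigcup_n (D n `&` no_visit X A n s).
  rewrite setI_bigcupr; apply: eq_bigcupr => n _.
  by rewrite /D setIA [in RHS](setIC (visit_at _ _)).
have -> : P nu [set w | Q (Z w)] = P nu (\bigcup_n D n).
  rewrite /D -setI_bigcupl.
  have mV : measurable (\bigcup_n visit_at N.+1 n).
    by apply: bigcup_measurable => n _; exact: measurable_visit_at.
  rewrite setIC [LHS](measureDI _ mZ mV) [X in (X + _)%E](_ : _ = 0%E) ?add0e//.
  apply/negligibleP; first exact: measurableD.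
  apply: negligibleS (ae_visits_dvg hX mA atom harris nu Ax).
  move=> w [_ nV] /= /cvgnyPge/(_ N.+1)[n _ /(_ n (leqnn n)) Nn]; apply: nV.
  by have [m [/andP[m0 _] Xm vm]] := visits_gt_exists Nn; exists m.
rewrite measure_bigcup//; last 2 first.
- by move=> n _; apply: measurableI => //; exact: measurable_no_visit.
- apply/trivIsetP => i j _ _ /eqP ij; apply/seteqP; split => // w.
  by move=> [[[Vi _] _] [[Vj _] _]]; exact: ij (visit_at_inj Vi Vj).
rewrite measure_bigcup// muleC -nneseriesZl//; apply: eq_eseriesr => n _.
have := prob_no_visit_atom hX mA atom nu s Ax (hD n).
rewrite muleC fineK// => h; apply: h.
by move=> w [[_ /set_mem]].
Qed.
End durations.

(** * Almost sure convergence of relative frequencies *)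

Lemma nneseries_telescope_lty (R : realType) (f : nat -> \bar R)
    (g : nat -> R) :
    (forall n, 0 <= f n <= (g n - g n.+1)%:E)%E -> (forall n, 0 <= g n) ->
  (\sum_(n <oo) f n < +oo)%E.
Proof.
move=> fg g0; have f0 n : (0 <= f n)%E by have /andP[] := fg n.
apply: (@le_lt_trans _ _ (g 0%N)%:E); last by rewrite ltry.
apply: lime_le; first by apply: is_cvg_nneseries => n _ _; exact: f0.
apply: nearW => N; apply: (@le_trans _ _ (g 0%N - g N)%:E).
  elim: N => [|N IH]; first by rewrite big_geq// subrr.
  rewrite big_nat_recr//=; have /andP[_ fN] := fg N.
  by apply: (le_trans (leeD IH fN)); rewrite -EFinD lee_fin; lra.
by rewrite lee_fin gerBl.
Qed.

(** The trials and their probability may change with the number of trials, as in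
a triangular array; the bounds are summable once the expected number of
successes exceeds a large multiple of [ln n]. *)
Section chernoff_borel_cantelli.
Context (R : realType) (d : measure_display) (T : measurableType d)
  (P : probability T R) (B : nat -> nat -> set T) (p : nat -> R).
Hypothesis trB : forall n, bernoulli_trials P (B n) (p n).
Hypothesis big_p : forall M : R, \forall n \near \oo, M * ln n%:R <= n%:R * p n.

Let bad (e : R) n : set T :=
  [set w | (1 + e) * (n%:R * p n) <= (nb_occ (B n) n w)%:R] `|`
  [set w | (nb_occ (B n) n w)%:R <= (1 - e) * (n%:R * p n)].

Let measurable_ge (e : R) n :
  measurable [set w | (1 + e) * (n%:R * p n) <= (nb_occ (B n) n w)%:R].
Proof.
have [mB _] := trB n.
exact: (@measurable_nb_occ _ _ _ n (fun k => (1 + e) * (n%:R * p n) <= k%:R)).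
Qed.

Let measurable_le (e : R) n :
  measurable [set w | (nb_occ (B n) n w)%:R <= (1 - e) * (n%:R * p n)].
Proof.
have [mB _] := trB n.
exact: (@measurable_nb_occ _ _ _ n (fun k => k%:R <= (1 - e) * (n%:R * p n))).
Qed.

Let ae_eventually_good (e : R) : 0 < e <= 1 ->
  {ae P, forall w, \forall n \near \oo, ~ bad e n w}.
Proof.
move=> e01; have e0 : 0 < e by case/andP: e01.
have [n0 _ n0P] := big_p (16 / e ^+ 2).
pose F i := bad e (i + n0.+1)%N.
have mF i : measurable (F i) by apply: measurableU.
have PF : P (lim_sup_set F) = 0%E.
  apply: lim_sup_set_cvg0 => //.
  apply: (@nneseries_telescope_lty _ _ (fun i => 4 / (i + n0.+1)%:R)) => [i|i];
    last by rewrite divr_ge0.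
  rewrite measure_ge0/=.
  have nn : (n0 <= i + n0.+1)%N by rewrite addnS ltnW// ltnS leq_addl.
  have := n0P _ nn; rewrite /= /F.
  have : (0 < i + n0.+1)%N by rewrite addnS.
  set n := (i + n0.+1)%N => n_gt0 lnn.
  apply: (le_trans (measureU2 _ (measurable_ge e n) (measurable_le e n))).
  apply: (le_trans (leeD (chernoff_upper _ (trB n) e01)
    (chernoff_lower _ (trB n) e01))).
  rewrite -EFinD lee_fin.
  have nR : (0 : R) < n%:R by rewrite ltr0n.
  (* The constant [16 / e^2] is the one for which the Chernoff exponent
     reaches [2 ln n]. *)
  have : expR (- (e ^+ 2 / 8 * (n%:R * p n))) <= n%:R ^- 2.
    rewrite -[X in _ <= X]lnK ?posrE ?invr_gt0 ?exprn_gt0// ler_expR.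
    rewrite lnV ?posrE ?exprn_gt0// lnXn// lerN2.
    have -> : ln n%:R *+ 2 = e ^+ 2 / 8 * (16 / e ^+ 2 * ln n%:R).
      by field; rewrite gt_eqF.
    by rewrite ler_wpM2l// divr_ge0// sqr_ge0.
  set x := expR _ => xn.
  rewrite addSn -/n -[n.+1%:R]natr1.
  have -> : 4 / n%:R - 4 / (n%:R + 1) = 4 / (n%:R * (n%:R + 1)) :> R.
    by field; rewrite !gt_eqF//; lra.
  apply: (@le_trans _ _ (2 * n%:R ^- 2)); first by lra.
  have -> : 2 * n%:R ^- 2 = 4 / (n%:R * (n%:R + n%:R)) :> R.
    by field; rewrite !gt_eqF//; lra.
  rewrite ler_pM2l// lef_pV2 ?posrE ?mulr_gt0//; [|lra..].
  rewrite ler_pM2l// lerD2l.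
  by rewrite ler1n.
apply: (@negligibleS _ _ _ _ (lim_sup_set F)); last first.
  apply/negligibleP => //; apply: bigcap_measurable => // k _.
  by apply: bigcup_measurable.
move=> w; apply: contra_notP => nF.
move/existsNP : nF => [k /not_implyP[_ nF]].
exists (k + n0.+1)%N => // n /= kn badn; apply: nF.
exists (n - n0.+1)%N => /=; first lia.
by rewrite /F subnK//; lia.
Qed.

Lemma ae_nb_occ_ratio_cvg1 :
  {ae P, forall w,
    (nb_occ (B n) n w)%:R / (n%:R * p n) @[n --> \oo] --> (1 : R)}.
Proof.
have : {ae P, forall w, forall q : nat,
    \forall n \near \oo, ~ bad (q.+1%:R^-1) n w}.
  apply/ae_foralln => q; apply: ae_eventually_good.
  by rewrite invr_gt0 ltr0n/= invf_le1 ?ler1n.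
apply: filterS => w good; apply/cvgrPdist_lt => e e0.
have [q qe] : exists q : nat, q.+1%:R^-1 < e.
  have := near_infty_natSinv_lt (PosNum e0) => -[N _ /(_ N (leqnn N)) Ne].
  by exists N.
near=> n.
have badn : ~ bad q.+1%:R^-1 n w by near: n; exact: good.
have np : 0 < n%:R * p n.
  apply: (@lt_le_trans _ _ (1 * ln n%:R)); last by near: n; exact: big_p.
  by rewrite mul1r ln_gt0// ltr1n; near: n; exact: nbhs_infty_gt.
apply: le_lt_trans qe.
have [/negP h1 /negP h2] := (not_orP _ _).1 badn.
move: h1 h2; rewrite -!ltNge => h1 h2.
have {}h1 : (nb_occ (B n) n w)%:R / (n%:R * p n) <= 1 + q.+1%:R^-1.
  by rewrite ler_pdivrMr// ltW.
have {}h2 : 1 - q.+1%:R^-1 <= (nb_occ (B n) n w)%:R / (n%:R * p n).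
  by rewrite ler_pdivlMr// ltW.
by rewrite distrC ler_distl; apply/andP; split.
Unshelve. all: by end_near. Qed.
End chernoff_borel_cantelli.

(** * Slow variation along equivalent sequences *)

(** Uniqueness of Lebesgue measure, checked on half-open intervals. *)
Lemma lebesgue_measure_scale (R : realType) (r : R) (B : set R) :
    0 < r -> measurable B ->
  lebesgue_measure [set x | B (r * x)] = (r^-1%:E * lebesgue_measure B)%E.
Proof.
move=> r0 mB.
have mr : measurable_fun setT (fun x : R => r * x : measurableTypeR R).
  exact: mulrl_measurable.
pose m : {measure set (measurableTypeR R) -> \bar R} :=
  mscale (NngNum (ltW r0))
    (pushforward lebesgue_measure (fun x : R => r * x : measurableTypeR R)).
have : lebesgue_measure B = m mr B.
  apply: lebesgue_measure_unique => // _ [[a b]] _ <-.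
  change (lebesgue_measure [set` `]a, b]%R] =
    r%:E * lebesgue_measure [set x : R | [set` `]a, b]%R] (r * x)%R])%E.
  rewrite [X in (_ * lebesgue_measure X)%E](_ : _ =
    [set` `]a / r, b / r]%R]); last first.
    apply/seteqP; split => x /=; rewrite !in_itv/= ltr_pdivrMr// ler_pdivlMr//;
      by rewrite (mulrC x).
  rewrite !lebesgue_measure_itv/= !lte_fin ltr_pM2r ?invr_gt0//.
  case: ifP => _; rewrite ?mule0//.
  rewrite -!EFinB -EFinM; congr (_%:E); field; exact: lt0r_neq0.
rewrite /m /mscale/= => ->.
by rewrite muleA -EFinM mulVf ?mul1e// gt_eqF.
Qed.

Section slow_variation.
Context (R : realType) (L : R -> R).
Hypothesis svL : slowly_varying L.
Let I12 : set R := `[1, 2]%classic.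

(** Egorov's theorem for the functions [l |-> L (l z_n) / L (z_n)] on [1, 2]. *)
Let almost_uniform (z : R^nat) :
    (forall n, 0 < z n) -> z n @[n --> \oo] --> +oo ->
  exists B : set R, [/\ measurable B, (lebesgue_measure B < (16^-1)%:E)%E &
    forall e : R, 0 < e -> \forall n \near \oo,
      forall l, I12 l -> ~ B l -> `|1 - L (l * z n) / L (z n)| < e].
Proof.
move=> z0 zoo; have [mL _ svl] := svL.
have muI : (lebesgue_measure I12 < +oo)%E.
  by rewrite /I12 lebesgue_measure_itv/= lte_fin ltr1n/= -EFinB ltry.
suff [B [mB Bs uB]] : exists B : set R,
    [/\ measurable B, (lebesgue_measure B < (16^-1)%:E)%E &
    {uniform I12 `\` B,
      (fun n l => L (l * z n) / L (z n)) @ \oo --> (fun _ => 1 : R)}].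
  exists B; split => // e e0.
  have UN : \forall n \near \oo,
      [set h | forall l, (I12 `\` B) l -> ball (1 : R) e (h l)]
        (fun l => L (l * z n) / L (z n)).
    apply: uB; apply/uniform_nbhs; exists [set xy | ball xy.1 e xy.2].
    by split => //; exact: (entourage_ball _ (PosNum e0)).
  by apply: filterS UN => n /= h l Il nBl; exact: h.
apply: (@pointwise_almost_uniform _ R (measurableTypeR R) (@lebesgue_measure R)
  (fun n l => L (l * z n) / L (z n)) (fun _ => 1) I12) => //.
- move=> n; have mLz : measurable_fun I12 (fun l => L (l * z n)).
    apply: (measurable_comp _ _ mL);
      [exact: measurable_itv| |exact: mulrr_measurable].
    move=> _ [l /= + <-]; rewrite /I12/= !in_itv/= andbT => /andP[l1 _].
    by apply: mulr_ge0; [apply: le_trans l1|exact: ltW].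
  have mf : measurable_fun I12 (fun l => L (l * z n) / L (z n)).
    exact: measurable_funM.
  exact: mf.
- exact: measurable_itv.
- move=> l; rewrite /I12/= in_itv/= => /andP[l1 _].
  have l0 : 0 < l by rewrite (lt_le_trans _ l1).
  exact: (cvg_comp _ _ zoo (svl l l0)).
Qed.

(** A Steinhaus argument. Outside of a small set of [l], both
[L (l z) / L z] and [L (r l y) / L y] are close to [1], where [r = z / y]; since
[r] is close to [1], the exceptional sets leave a common [l], and for it the two
numerators [L (l z)] and [L (r l y)] are the same. *)
Lemma slowly_varying_ratio (z y : R^nat) :
    (forall n, 0 < z n) -> (forall n, 0 < y n) ->
    z n @[n --> \oo] --> +oo -> y n @[n --> \oo] --> +oo ->
    z n / y n @[n --> \oo] --> (1 : R) ->
  L (y n) / L (z n) @[n --> \oo] --> (1 : R).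
Proof.
move=> z0 y0 zoo yoo zy1.
have [B1 [mB1 B1s u1]] := almost_uniform z0 zoo.
have [B2 [mB2 B2s u2]] := almost_uniform y0 yoo.
apply/cvgrPdist_lt => e e0.
pose e' := Num.min (e / 8) (2^-1).
have e'0 : 0 < e' by rewrite lt_min divr_gt0//= invr_gt0.
have e'e : e' <= e / 8 by rewrite ge_min lexx.
have e'2 : e' <= 2^-1 by rewrite ge_min lexx orbT.
near=> n.
have h1 : forall l, I12 l -> ~ B1 l -> `|1 - L (l * z n) / L (z n)| < e'.
  by near: n; exact: u1.
have h2 : forall l, I12 l -> ~ B2 l -> `|1 - L (l * y n) / L (y n)| < e'.
  by near: n; exact: u2.
have r34 : 3/4 <= z n / y n.
  by near: n; apply: (cvgr_ge _ zy1); lra.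
have r43 : z n / y n <= 4/3.
  by near: n; apply: (cvgr_le _ zy1); lra.
set r := z n / y n in r34 r43.
have r0 : 0 < r by rewrite divr_gt0.
(* The interval [J] has length [1 / 6] and is mapped into [1, 2] by [r]; the
   exceptional sets cover at most [1 / 16 + 4 / 3 * 1 / 16 < 1 / 6] of it. *)
pose J : set R := `[4/3, 3/2]%classic.
have [l [Jl nB1 nB2]] : exists l, [/\ J l, ~ B1 l & ~ B2 (r * l)].
  apply: contrapT => nex.
  have JB : J `<=` B1 `|` [set x | B2 (r * x)].
    move=> l Jl; apply: contrapT => /not_orP[nB1 nB2]; apply: nex.
    by exists l; split.
  have mB2r : measurable [set x | B2 (r * x)].
    have mr : measurable_fun setT (fun x : R => r * x).
      exact: mulrl_measurable.
    by have := mr measurableT _ mB2; rewrite setTI.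
  have : (lebesgue_measure J <= (16^-1 + r^-1 * 16^-1)%:E)%E.
    apply: (@le_trans _ _ (lebesgue_measure (B1 `|` [set x | B2 (r * x)]))).
      apply: le_measure; rewrite ?inE//; last exact: measurableU.
      exact: measurable_itv.
    apply: (@le_trans _ _
      (lebesgue_measure B1 + lebesgue_measure [set x | B2 (r * x)%R])%E).
      exact: measureU2.
    rewrite lebesgue_measure_scale// EFinD; apply: leeD; first exact: ltW.
    rewrite EFinM; apply: lee_wpmul2l; first by rewrite lee_fin invr_ge0 ltW.
    exact: ltW.
  rewrite lebesgue_measure_itv/= lte_fin ifT; last lra.
  rewrite -EFinB lee_fin leNgt => /negP; apply.
  have : r^-1 <= 4 / 3.
    by rewrite -[4 / 3]invrK lef_pV2 ?posrE ?invr_gt0//; lra.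
  lra.
move: Jl; rewrite /J/= in_itv/= => /andP[l1 l2].
have I12l : I12 l by rewrite /I12/= in_itv/=; apply/andP; split; lra.
have I12rl : I12 (r * l) by rewrite /I12/= in_itv/=; apply/andP; split; nra.
have {h1} := h1 l I12l nB1; have {h2} := h2 _ I12rl nB2.
have -> : r * l * y n = l * z n by rewrite /r; field; rewrite gt_eqF.
set b := L (l * z n); rewrite !ltr_norml => /andP[g1 g2] /andP[f1 f2].
have Ly0 : L (y n) != 0.
  by apply: contraTneq g2 => ->; rewrite invr0 mulr0 subr0 -leNgt; lra.
have Lz0 : L (z n) != 0.
  by apply: contraTneq f2 => ->; rewrite invr0 mulr0 subr0 -leNgt; lra.
set f := b / L (z n) in f1 f2; set g := b / L (y n) in g1 g2.
have g0 : 0 < g by lra.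
have b0 : b != 0 by apply: contraTneq g0 => b0; rewrite /g b0 mul0r ltxx.
have -> : L (y n) / L (z n) = f / g.
  by rewrite /f /g; field; rewrite ?Ly0 ?Lz0 ?b0.
have -> : 1 - f / g = (g - f) / g by field; rewrite gt_eqF.
rewrite ltr_pdivrMr// ltr_pdivlMr//.
apply/andP; split; nra.
Unshelve. all: by end_near. Qed.
End slow_variation.

(** * Regularly varying tails *)

Lemma near_eq_cvg_nat (R : realType) (f g : R^nat) (l : R) :
    (\forall n \near \oo, f n = g n) ->
  f n @[n --> \oo] --> l -> g n @[n --> \oo] --> l.
Proof.
move=> fg; apply: cvg_trans; apply: near_eq_cvg.
by apply: filterS fg => n ->.
Qed.

Lemma cvg_natr_pinfty (R : realType) : (n%:R : R) @[n --> \oo] --> +oo.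
Proof.
apply/cvgryPge => M; exists (Num.truncn `|M|).+1 => // n /= Mn.
have := truncnS_gt `|M|; have := ler_norm M.
by move: Mn; rewrite -(ler_nat R) => h1 h2 h3; lra.
Qed.

Lemma cvg_ln_natr_pinfty (R : realType) : ln (n%:R : R) @[n --> \oo] --> +oo.
Proof.
apply/cvgryPge => M; have /cvgryPge/(_ (expR M)) := @cvg_natr_pinfty R.
apply: filterS => n Mn; rewrite -ler_expR lnK// posrE.
by rewrite (lt_le_trans _ Mn)// expR_gt0.
Qed.

Lemma cvg_expR_pinfty (R : realType) (k : R^nat) :
  k n @[n --> \oo] --> +oo -> expR (k n) @[n --> \oo] --> +oo.
Proof.
move=> /cvgryPge koo; apply/cvgryPge => M; apply: filterS (koo M) => n Mn.
by have := expR_ge1Dx (k n); lra.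
Qed.

Lemma cvg_truncnS_ratio (R : realType) (z : R^nat) :
    (forall n, 0 < z n) -> z n @[n --> \oo] --> +oo ->
  z n / (Num.truncn (z n)).+1%:R @[n --> \oo] --> (1 : R).
Proof.
move=> z0 /cvgryPge zoo; apply/cvgrPdist_lt => e e0.
near=> n; have zn : e^-1 < z n.
  by apply: (@lt_le_trans _ _ (e^-1 + 1)); [rewrite ltrDl|near: n; exact: zoo].
have /andP[t1 t2] := truncn_itv (ltW (z0 n)).
have e'0 : 0 < e^-1 by rewrite invr_gt0.
set y : R := (Num.truncn (z n)).+1%:R in t2 *.
have yE : y <= z n + 1 by rewrite /y -natr1 lerD2r.
have y0 : 0 < y by rewrite /y ltr0n.
have -> : 1 - z n / y = (y - z n) / y by field; rewrite gt_eqF.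
rewrite ger0_norm; last by apply: divr_ge0; lra.
rewrite ltr_pdivrMr//.
have : e * e^-1 < e * y by rewrite ltr_pM2l//; lra.
by rewrite mulfV ?gt_eqF//; lra.
Unshelve. all: by end_near. Qed.

Lemma powR_div (R : realType) (x y a : R) : 0 < x -> 0 < y ->
  (x / y) `^ a = x `^ a / y `^ a.
Proof.
move=> x0 y0; have ya : y `^ a != 0 by rewrite gt_eqF// powR_gt0.
by apply: (mulIf ya); rewrite divfK// -powRM ?divfK ?gt_eqF// ?ltW// divr_gt0.
Qed.

(** Here [F s] stands for the probability of a duration larger than [s], that is
at least [s + 1]; this is why [L] is taken at successors. *)
Section regularly_varying_tail.
Context (R : realType) (L : R -> R) (beta : R) (F : nat -> R).
Hypotheses (svL : slowly_varying L) (beta01 : 0 < beta < 1).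
Hypothesis FE : forall s, F s = L s.+1%:R * s.+1%:R `^ (- beta).
Let tr (z : R) := Num.truncn z.
Let up (z : R) : R := (tr z).+1%:R.

Let up_gt0 z : 0 < up z. Proof. by rewrite /up ltr0n. Qed.

Let L_ge0 z : 0 <= z -> 0 <= L z. Proof. by case: svL => _ h _; exact: h. Qed.

Let cvg_up (z : R^nat) :
  z n @[n --> \oo] --> +oo -> up (z n) @[n --> \oo] --> +oo.
Proof.
move=> /cvgryPge zoo; apply/cvgryPge => M; apply: filterS (zoo M) => n Mn.
by rewrite (le_trans Mn)// ltW// truncnS_gt.
Qed.

Let cvg_L_up (z : R^nat) : (forall n, 0 < z n) -> z n @[n --> \oo] --> +oo ->
  L (up (z n)) / L (z n) @[n --> \oo] --> (1 : R).
Proof.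
move=> z0 zoo; apply: slowly_varying_ratio => //.
- exact: cvg_up.
- exact: cvg_truncnS_ratio.
Qed.

(** The arguments of [L] are moved from the integers [tr _ + 1] to the reals
[l z] and [z], where slow variation compares them. *)
Lemma cvg_tail_ratio (l : R) (z : R^nat) : 0 < l -> (forall n, 0 < z n) ->
    z n @[n --> \oo] --> +oo ->
  F (tr (l * z n)) / F (tr (z n)) @[n --> \oo] --> (l `^ (- beta) : R).
Proof.
move=> l0 z0 zoo.
have lz0 n : 0 < l * z n by rewrite mulr_gt0.
have lzoo : l * z n @[n --> \oo] --> +oo.
  exact: (cvg_comp _ _ zoo (gt0_cvgMry l0 cvg_id)).
have c1 := cvg_L_up lz0 lzoo.
have c2 := cvg_L_up z0 zoo.
have c3 : L (l * z n) / L (z n) @[n --> \oo] --> (1 : R).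
  by have [_ _ svl] := svL; exact: (cvg_comp _ _ zoo (svl l l0)).
have c4 := cvg_truncnS_ratio lz0 lzoo.
have c5 := cvg_truncnS_ratio z0 zoo.
have c6 : up (l * z n) / up (z n) @[n --> \oo] --> l.
  have c : (l * z n / up (l * z n))^-1 * (z n / up (z n)) * l @[n --> \oo]
      --> 1^-1 * 1 * l.
    by apply: cvgM; [apply: cvgM => //; exact: cvgV|exact: cvg_cst].
  rewrite invr1 !mul1r in c; apply: near_eq_cvg_nat c; apply: nearW => n.
  by rewrite /up /tr; field; rewrite ?gt_eqF//= ?z0//= ?l0//= !nat1r ?ltr0n.
have c7 : (up (l * z n) / up (z n)) `^ (- beta) @[n --> \oo] --> l `^ (- beta).
  have lE : l `^ (- beta) = expR (- beta * ln l) by rewrite /powR gt_eqF.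
  rewrite lE.
  have c : expR (- beta * ln (up (l * z n) / up (z n))) @[n --> \oo]
      --> expR (- beta * ln l).
    apply: continuous_cvg; first exact: continuous_expR.
    apply: cvgMr; apply: continuous_cvg => //; exact: continuous_ln.
  apply: near_eq_cvg_nat c; apply: nearW => n.
  by rewrite /powR gt_eqF// divr_gt0 ?up_gt0.
have c : L (up (l * z n)) / L (l * z n) * (L (l * z n) / L (z n)) *
    (L (up (z n)) / L (z n))^-1 * (up (l * z n) / up (z n)) `^ (- beta)
    @[n --> \oo] --> 1 * 1 * 1^-1 * l `^ (- beta).
  by apply: cvgM => //; apply: cvgM; [exact: cvgM|exact: cvgV].
rewrite invr1 !mul1r in c; apply: near_eq_cvg_nat c; near=> n.
have neq0 (a b : R) : 0 < a / b -> a != 0 /\ b != 0.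
  move=> ab; split; apply: contraTneq ab => ->; first by rewrite mul0r ltxx.
  by rewrite invr0 mulr0 ltxx.
have [Lulz Llz] : L (up (l * z n)) != 0 /\ L (l * z n) != 0.
  by apply: neq0; near: n; exact: (cvgr_gt _ c1).
have [Luz Lz] : L (up (z n)) != 0 /\ L (z n) != 0.
  by apply: neq0; near: n; exact: (cvgr_gt _ c2).
have uz : up (z n) `^ (- beta) != 0 by rewrite gt_eqF// powR_gt0 ?up_gt0.
rewrite !FE -!/(up _) powR_div ?up_gt0//.
by field; rewrite Luz Lz Llz uz.
Unshelve. all: by end_near. Qed.

(** The hypothesis controls [L (z) z^(- beta)] at [z = exp (k n)]. Passing to the
integer [tr z + 1], between [z] and [2 z] for large [n], costs at most a factor
[2] for [L] and another one for the power, hence the constant [4]. *)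
Lemma tail_dominates_ln (k : R^nat) : k n @[n --> \oo] --> +oo ->
    (fun n : nat => ln (n%:R : R) * expR (k n * beta) / n%:R)
       =o_\oo (fun n : nat => L (expR (k n))) ->
  forall M : R, \forall n \near \oo, M * ln n%:R <= n%:R * F (tr (expR (k n))).
Proof.
move=> koo /eqoP small M; have /andP[b0 b1] := beta01.
have zoo := cvg_expR_pinfty koo.
have z0 n : 0 < expR (k n) by exact: expR_gt0.
have c1 := cvg_L_up z0 zoo.
have c5 := cvg_truncnS_ratio z0 zoo.
pose M1 := Num.max M 1; have M1_gt0 : 0 < M1 by rewrite lt_max ltr01 orbT.
have eps0 : 0 < (4 * M1)^-1 by rewrite invr_gt0 mulr_gt0.
near=> n.
have n0 : 0 < n%:R :> R by rewrite ltr0n; near: n; exact: nbhs_infty_gt.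
have ln0 : 0 <= ln n%:R :> R by rewrite ln_ge0// ler1n -(ltr0n R).
have : `|ln n%:R * expR (k n * beta) / n%:R| <= (4 * M1)^-1 * `|L (expR (k n))|.
  by near: n; exact: small.
rewrite !ger0_norm ?L_ge0 ?expR_ge0 ?divr_ge0 ?mulr_ge0 ?expR_ge0//.
have Lu : 2^-1 <= L (up (expR (k n))) / L (expR (k n)).
  by near: n; apply: (cvgr_ge _ c1); lra.
have zu : 2^-1 <= expR (k n) / up (expR (k n)).
  by near: n; apply: (cvgr_ge _ c5); lra.
rewrite FE -/(up _) expRM; set z := expR (k n) in Lu zu *.
have {}z0 : 0 < z by exact: expR_gt0.
have u0 := up_gt0 z.
have Lz0 : 0 < L z.
  rewrite lt_neqAle L_ge0 ?ltW// andbT eq_sym.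
  by apply: contraTneq Lu => ->; rewrite invr0 mulr0 -ltNge; lra.
move=> h.
have {}Lu : L z / 2 <= L (up z) by rewrite ler_pdivlMr// mulrC in Lu.
set w := z `^ beta in h; have w0 : 0 < w by exact: powR_gt0.
have ub : (2 * w)^-1 <= up z `^ (- beta).
  rewrite powRN lef_pV2 ?posrE ?powR_gt0 ?mulr_gt0//.
  have uz : up z <= 2 * z by move: zu; rewrite ler_pdivlMr// => zu; lra.
  apply: (@le_trans _ _ ((2 * z) `^ beta)).
    by apply: ge0_ler_powR; rewrite ?nnegrE; lra.
  have -> : (2 * z) `^ beta = 2 `^ beta * w by rewrite /w powRM// ltW.
  have : 2 `^ beta <= 2 `^ 1 :> R by apply: ler_powR; lra.
  by rewrite powRr1// ler_pM2r.
have {}h : 4 * M1 * (ln n%:R * w) <= n%:R * L z.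
  have c0 : 0 <= 4 * M1 * n%:R by rewrite !mulr_ge0// ltW.
  have := ler_wpM2r c0 h.
  have -> : ln n%:R * w / n%:R * (4 * M1 * n%:R) = 4 * M1 * (ln n%:R * w).
    by field; rewrite gt_eqF.
  suff -> : (4 * M1)^-1 * L z * (4 * M1 * n%:R) = n%:R * L z by [].
  by field; rewrite gt_eqF.
have MM1 : M * ln n%:R <= M1 * ln n%:R by rewrite ler_wpM2r// le_max lexx.
apply: (le_trans MM1).
apply: (@le_trans _ _ (n%:R * (L z / 2 * (2 * w)^-1))); last first.
  rewrite ler_pM2l//; apply: ler_pM => //; last by rewrite invr_ge0; lra.
  by rewrite divr_ge0 ?ltW.
have -> : n%:R * (L z / 2 * (2 * w)^-1) = n%:R * L z / (4 * w).
  by field; rewrite gt_eqF.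
by rewrite ler_pdivlMr ?mulr_gt0//; lra.
Unshelve. all: by end_near. Qed.

End regularly_varying_tail.

Section regularly_varying_tail_lower_bound.
Context (R : realType) (L : R -> R) (beta : R) (F : nat -> R).
Hypotheses (svL : slowly_varying L) (beta01 : 0 < beta < 1).
Hypothesis FE : forall s, F s = L s.+1%:R * s.+1%:R `^ (- beta).
Hypothesis F_ninc : forall m n, (m <= n)%N -> F n <= F m.

Let pow2E j : ((2 ^ j).-1.+1)%N = (2 ^ j)%N.
Proof. by rewrite prednK// expn_gt0. Qed.

(** As [L (2 u) / L u] tends to [1], it eventually exceeds [2^(beta - 1) < 1], so
that doubling the argument at most halves the tail. Monotonicity fills the gaps
between powers of two. *)
Lemma tail_ge_inv : exists2 c : R, 0 < c &
  \forall s \near \oo, c / s.+1%:R <= F s.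
Proof.
have /andP[b0 b1] := beta01; have [_ L0 svl] := svL.
have uoo : ((2 ^ j)%:R : R) @[j --> \oo] --> +oo.
  apply/cvgryPge => M; have /cvgryPge/(_ M) := @cvg_natr_pinfty R.
  apply: filterS => n /le_trans; apply; rewrite ler_nat ltnW//.
  exact: ltn_expl.
have two_gt0 : 0 < 2 :> R by [].
have c1 := cvg_comp _ _ uoo (svl 2 two_gt0).
have : \forall j \near \oo,
    2 `^ (beta - 1) <= L (2 * (2 ^ j)%:R) / L (2 ^ j)%:R.
  apply: (cvgr_ge _ c1).
  rewrite -[ltRHS](powRr0 2) /powR ifF ?pnatr_eq0// ltr_expR mul0r.
  by rewrite pmulr_llt0 ?ln_gt0//; lra.
move=> [i0 _ i0P].
have Lpos j : (i0 <= j)%N -> 0 < L (2 ^ j)%:R.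
  move=> /i0P /= h; rewrite lt_neqAle L0// andbT eq_sym.
  by apply: contraTneq h => ->; rewrite invr0 mulr0 -ltNge powR_gt0.
have step j : (i0 <= j)%N -> F (2 ^ j).-1 / 2 <= F (2 ^ j.+1).-1.
  move=> ij; rewrite !FE !pow2E expnS natrM powRM//.
  have := i0P _ ij => /=; rewrite ler_pdivlMr ?Lpos// => h.
  set u : R := (2 ^ j)%:R in h *.
  have : 2 `^ (beta - 1) * L u * (2 `^ (- beta) * u `^ (- beta)) <=
      L (2 * u) * (2 `^ (- beta) * u `^ (- beta)).
    by rewrite ler_wpM2r// mulr_ge0// powR_ge0.
  apply: le_trans; rewrite le_eqVlt; apply/orP; left; apply/eqP.
  have -> : 2 `^ (beta - 1) * L u * (2 `^ (- beta) * u `^ (- beta)) =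
    2 `^ (beta - 1) * 2 `^ (- beta) * (L u * u `^ (- beta)) by ring.
  rewrite -powRD ?pnatr_eq0 ?implybT//.
  by rewrite (_ : beta - 1 + - beta = -1) ?powR_inv1//; ring.
pose c0 := F (2 ^ i0).-1 * (2 ^ i0)%:R.
have c0_gt0 : 0 < c0.
  by rewrite /c0 FE pow2E !mulr_gt0// ?powR_gt0 ?ltr0n ?expn_gt0//; exact: Lpos.
have dyadic j : (i0 <= j)%N -> c0 / (2 ^ j)%:R <= F (2 ^ j).-1.
  move=> /subnKC <-; elim: (j - i0)%N => [|i IH].
    by rewrite addn0 /c0 mulfK// pnatr_eq0 -lt0n expn_gt0.
  rewrite addnS; apply: le_trans (step _ (leq_addr _ _)).
  rewrite expnS natrM invfM mulrCA mulrC.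
  by rewrite ler_pM2r.
exists (c0 / 2); first by rewrite divr_gt0.
exists (2 ^ i0)%N => // s /= is_.
have /andP[t1 t2] := @trunc_log_bounds 2 s.+1 isT isT.
set t := trunc_log 2 s.+1 in t1 t2.
have it : (i0 <= t.+1)%N.
  by rewrite -(@leq_exp2l 2)// (leq_trans is_)// ltnW// (ltn_trans _ t2).
apply: le_trans (_ : F (2 ^ t.+1).-1 <= _); last first.
  by apply: F_ninc; rewrite -ltnS pow2E ltnW.
apply: le_trans (dyadic _ it).
rewrite -mulrA -invfM ler_pM2l// lef_pV2 ?posrE ?mulr_gt0 ?ltr0n ?expn_gt0//.
by rewrite -natrM ler_nat expnS leq_mul2l.
Qed.

(** By [tail_ge_inv], [n F (n^A0)] is of order at least [n^(1 - A0)]. *)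
Lemma tail_dominates_ln_power (A0 : R) : 0 < A0 < 1 ->
  forall M : R, \forall n \near \oo,
    M * ln n%:R <= n%:R * F (Num.truncn (expR (A0 * ln n%:R))).
Proof.
move=> /andP[a0 a1] M; have [c c0 [s0 _ s0P]] := tail_ge_inv.
have lnoo : A0 * ln (n%:R : R) @[n --> \oo] --> +oo.
  exact: (cvg_comp _ _ (@cvg_ln_natr_pinfty R) (gt0_cvgMry a0 cvg_id)).
have /cvgryPge zoo := cvg_expR_pinfty lnoo.
have /cvgryPge lnoo' := @cvg_ln_natr_pinfty R.
near=> n.
have n0 : 0 < n%:R :> R by rewrite ltr0n; near: n; exact: nbhs_infty_gt.
have zs : s0.+1%:R <= expR (A0 * ln n%:R) by near: n; exact: zoo.
have ll : `|M| * 4 / (c * (1 - A0) ^+ 2) <= ln (n%:R : R).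
  by near: n; exact: lnoo'.
have ll1 : 0 <= ln (n%:R : R) by near: n; exact: lnoo'.
set z := expR _ in zs *.
have z0 : 0 < z by exact: expR_gt0.
have Fs : c / (Num.truncn z).+1%:R <= F (Num.truncn z).
  apply: s0P => /=; rewrite truncn_ge_nat; last exact: ltW.
  by apply: le_trans zs; rewrite ler_nat.
have z1 : 1 <= z by rewrite (le_trans _ zs)// ler1n.
have sz : (Num.truncn z).+1%:R <= 2 * z.
  by have := truncn_itv (ltW z0) => /andP[+ _]; rewrite -natr1; lra.
apply: (@le_trans _ _ (n%:R * (c / (2 * z)))); last first.
  rewrite ler_pM2l//; apply: le_trans Fs.
  by rewrite ler_pM2l// lef_pV2 ?posrE ?ltr0n// mulr_gt0.
have -> : n%:R * (c / (2 * z)) = c / 2 * (n%:R / z) by field; rewrite gt_eqF.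
have -> : n%:R / z = expR ((1 - A0) * ln n%:R).
  by rewrite -[X in X / z]lnK ?posrE// /z -expRB; congr expR; ring.
set x := (1 - A0) * ln n%:R.
have x0 : 0 <= x by rewrite mulr_ge0//; lra.
have := expR_ge1Dxn 1 x0; rewrite (_ : 2`!%:R = 2)// => hx.
apply: (@le_trans _ _ (c / 2 * (x ^+ 2 / 2))); last first.
  by rewrite ler_pM2l ?divr_gt0//; lra.
have -> : c / 2 * (x ^+ 2 / 2) = c * (1 - A0) ^+ 2 / 4 * ln n%:R * ln n%:R.
  by rewrite /x; field.
rewrite ler_wpM2r//; apply: le_trans (ler_norm M) _.
have ca : 0 < c * (1 - A0) ^+ 2 by rewrite mulr_gt0// exprn_gt0//; lra.
by move: ll; rewrite ler_pdivrMr//; lra.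
Unshelve. all: by end_near. Qed.

End regularly_varying_tail_lower_bound.

(** * Consistency of the estimator *)

Section estimator.
Context (R : realType) (d d' : measure_display) (E : measurableType d)
  (T : measurableType d') (Pi : R.-pker E ~> E) (X : nat -> {mfun T >-> E})
  (P : probability E R -> probability T R) (A : set E) (beta : R) (L : R -> R).
Hypotheses (hX : markov_family Pi X P) (mA : measurable A).
Hypothesis atom : forall x y, A x -> A y ->
  forall B, measurable B -> Pi x B = Pi y B.
Hypothesis harris :
  forall x, law_at P x (lim_sup_set (fun n => X n @^-1` A)) = 1%E.
Hypotheses (beta01 : 0 < beta < 1) (reg : regular_chain X P A beta L).
Variable a : E.
Hypothesis Aa : A a.

Let F s : R := fine (avoid Pi A s a).

Let avoid_fin s : avoid Pi A s a = (F s)%:E.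
Proof.
rewrite /F fineK// -(law_at_no_visit0 hX mA); apply: fin_num_measure.
exact: measurable_no_visit.
Qed.

Lemma tail_regular s : F s = L s.+1%:R * s.+1%:R `^ (- beta).
Proof.
apply: EFin_inj; rewrite -avoid_fin.
have [_ tailA] := reg; rewrite -(tailA _ a)//.
rewrite -(law_at_no_visit0 hX mA); congr (law_at P a _).
apply/seteqP; split => w; rewrite /no_visit /mkset visits0 add0n => v0.
  have : (s%:R%:E < tau R X A 1 w)%E by rewrite ltNge tau_le v0.
  have [->|[m ->]] := tau_nat R X A 1 w; first by rewrite leey.
  by rewrite lte_fin lee_fin ltr_nat ler_nat.
apply/eqP; rewrite -leqn0 -ltnS ltnNge; apply/negP.
rewrite -(@tau_le R) => /(le_trans v0); rewrite lee_fin ler_nat.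
by rewrite ltnn.
Qed.

Lemma tail_nonincreasing m n : (m <= n)%N -> F n <= F m.
Proof.
move=> mn; rewrite -lee_fin -!avoid_fin -!(law_at_no_visit0 hX mA).
apply: le_measure; rewrite ?inE; try exact: measurable_no_visit.
apply/subsetPset; exact: nonincreasing_no_visit.
Qed.

(** The growth condition passes from the level [exp (k n)] to [exp (k n + 1)]
because the two tails have comparable sizes; so both frequencies are equivalent
to their probabilities, and the ratio of the latter has the limit [exp beta]. *)
Lemma ae_beta_hat_cvg (nu : probability E R) (k : R^nat) :
    k n @[n --> \oo] --> +oo ->
    (forall M : R, \forall n \near \oo,
       M * ln n%:R <= n%:R * F (Num.truncn (expR (k n)))) ->
  {ae P nu, forall w, beta_hat X A n (k n) w @[n --> \oo] --> beta}.
Proof.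
move=> koo big.
have svL : slowly_varying L by case: reg.
have /andP[b0 b1] := beta01.
pose s n := Num.truncn (expR (k n)); pose s' n := Num.truncn (expR (k n + 1)).
have ratio : F (s' n) / F (s n) @[n --> \oo] --> expR (- beta).
  have := @cvg_tail_ratio _ _ _ _ svL tail_regular (expR 1)
    (fun n => expR (k n)) (expR_gt0 _) (fun n => expR_gt0 _)
    (cvg_expR_pinfty koo).
  rewrite -expRM mul1r; apply: near_eq_cvg_nat; apply: nearW => n.
  by rewrite /s' /s expRD [expR 1 * _]mulrC.
have Fpos : \forall n \near \oo, 0 < F (s n).
  have := big 1; apply: filterS2 (nbhs_infty_gt 1) => n n1; rewrite mul1r => h.
  have : 0 < n%:R * F (s n) by apply: lt_le_trans h; rewrite ln_gt0// ltr1n.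
  by rewrite pmulr_rgt0// ltr0n ltnW.
have big' M : \forall n \near \oo, M * ln n%:R <= n%:R * F (s' n).
  near=> n.
  have n1 : (1 < n)%N by near: n; exact: nbhs_infty_gt.
  have Fs : 0 < F (s n) by near: n; exact: Fpos.
  have rn : expR (- beta) / 2 <= F (s' n) / F (s n).
    near: n; apply: (cvgr_ge _ ratio).
    by have := expR_gt0 (- beta); lra.
  have bn : M * 2 / expR (- beta) * ln n%:R <= n%:R * F (s n).
    by near: n; exact: big.
  have e0 := expR_gt0 (- beta).
  move: rn; rewrite ler_pdivlMr// => rn.
  apply: (@le_trans _ _ (n%:R * (expR (- beta) / 2 * F (s n)))); last first.
    by rewrite ler_pM2l// ltr0n ltnW.
  have -> : n%:R * (expR (- beta) / 2 * F (s n)) =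
      expR (- beta) / 2 * (n%:R * F (s n)) by ring.
  apply: le_trans
    (_ : expR (- beta) / 2 * (M * 2 / expR (- beta) * ln n%:R) <= _).
    by rewrite le_eqVlt; apply/orP; left; apply/eqP; field; rewrite gt_eqF.
  by rewrite ler_pM2l// divr_gt0.
have trials m := bernoulli_trials_long_duration hX mA atom harris nu m Aa.
have ae1 := @ae_nb_occ_ratio_cvg1 _ _ _ (P nu)
  (fun n i => long_duration X A (s n) i.+1) (fun n => F (s n))
  (fun n => trials (s n)) big.
have ae2 := @ae_nb_occ_ratio_cvg1 _ _ _ (P nu)
  (fun n i => long_duration X A (s' n) i.+1) (fun n => F (s' n))
  (fun n => trials (s' n)) big'.
apply: filterS2 ae1 ae2 => w.
pose Z n := nb_occ (fun i => long_duration X A (s n) i.+1) n w.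
pose Z' n := nb_occ (fun i => long_duration X A (s' n) i.+1) n w.
move=> cvZ cvZ'.
have Z1 : (Z n)%:R / (n%:R * F (s n)) @[n --> \oo] --> (1 : R) := cvZ.
have Z'1 : (Z' n)%:R / (n%:R * F (s' n)) @[n --> \oo] --> (1 : R) := cvZ'.
have lnc : ln ((Z n)%:R / (n%:R * F (s n)) / ((Z' n)%:R / (n%:R * F (s' n))) /
    (F (s' n) / F (s n))) @[n --> \oo] --> beta.
  rewrite -[X in _ --> X]expRK; apply: continuous_cvg.
    exact/continuous_ln/expR_gt0.
  have -> : expR beta = 1 / 1 / expR (- beta).
    by rewrite expRN invrK divr1 mul1r.
  apply: cvgM; last by apply: cvgV => //; rewrite gt_eqF// expR_gt0.
  by apply: cvgM => //; apply: cvgV.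
apply: near_eq_cvg_nat lnc; near=> n.
have n0 : (0 < n)%N by near: n; exact: nbhs_infty_gt.
have nR : 0 < n%:R :> R by rewrite ltr0n.
have Fs : 0 < F (s n) by near: n; exact: Fpos.
have rn : 0 < F (s' n) / F (s n).
  by near: n; apply: (cvgr_gt _ ratio); exact: expR_gt0.
have Fs' : 0 < F (s' n) by rewrite pmulr_lgt0 ?invr_gt0 in rn.
have Z'n : 0 < (Z' n)%:R / (n%:R * F (s' n)) by near: n; exact: (cvgr_gt _ Z'1).
have {}Z'n : 0 < (Z' n)%:R :> R.
  by rewrite pmulr_lgt0 ?invr_gt0 ?mulr_gt0 in Z'n.
rewrite /beta_hat !p_hatE -/(Z n) -/(Z' n) divr_gt0//; congr ln.
by field; rewrite !gt_eqF.
Unshelve. all: by end_near. Qed.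

Lemma nb_durations_dvg nu :
  {ae P nu, forall w, nb_durations X A n w @[n --> \oo] --> \oo}.
Proof.
apply: filterS (ae_visits_dvg hX mA atom harris nu Aa) => w /cvgnyPge voo.
apply/cvgnyPge => K; apply: filterS (voo K.+1) => n Kn.
by rewrite /nb_durations leq_subRL ?add1n// (leq_trans _ Kn).
Qed.

End estimator.

Unset Implicit Arguments.
Set Strict Implicit.
Set Printing Implicit Defensive.

Theorem theorem3p2 (R : realType) (d d' : measure_display)
    (E : measurableType d) (T : measurableType d')
    (Pi : R.-pker E ~> E) (X : nat -> {mfun T >-> E})
    (P : probability E R -> probability T R)
    (psi : {sigma_finite_measure set E -> \bar R})
    (A : set E) (nu : probability E R) (beta : R) (L : R -> R)
    (hE : countably_generated E)
    (hX : markov_family Pi X P)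
    (hirr : irreducible X P psi)
    (haper : aperiodic Pi psi)
    (hharris : harris_recurrent X P psi)
    (hA : accessible_atom Pi psi A)
    (hbeta : 0 < beta < 1)
    (hreg : regular_chain X P A beta L) :
  (forall k : nat -> R,
     k n @[n --> \oo] --> +oo ->
     (fun n : nat => ln (n%:R : R) * expR (k n * beta) / n%:R)
       =o_\oo (fun n : nat => L (expR (k n))) ->
     {ae P nu, forall w,
        beta_hat X A (nb_durations X A n w) (k (nb_durations X A n w)) w
          @[n --> \oo] --> beta}) /\
  (forall A0 : R, 0 < A0 < 1 ->
     {ae P nu, forall w,
        beta_hat X A (nb_durations X A n w)
          (A0 * ln ((nb_durations X A n w)%:R : R)) w
          @[n --> \oo] --> beta}).
Proof.
have [mA psiA atom] := hA.
have [a Aa] : exists a, A a.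
  apply: contrapT => /forallNP A0; move: psiA.
  rewrite (_ : A = set0) ?measure0 ?ltxx//.
  by apply/seteqP; split => x // /A0.
have harris := hharris A mA psiA.
have svL : slowly_varying L by case: hreg.
have tailE := tail_regular hX mA hreg Aa.
(* The number of durations tends to infinity, so a limit in the sample size
   persists when the size is that random number. *)
have random_index (k : nat -> R) :
    {ae P nu, forall w, beta_hat X A n (k n) w @[n --> \oo] --> beta} ->
    {ae P nu, forall w, beta_hat X A (nb_durations X A n w)
      (k (nb_durations X A n w)) w @[n --> \oo] --> beta}.
  apply: filterS2 (nb_durations_dvg hX mA atom harris Aa nu) => w Noo cv.
  exact: (cvg_comp _ _ Noo cv).
split => [k koo small|A0 A01].
  apply: random_index.
  apply: (ae_beta_hat_cvg hX mA atom harris hbeta hreg Aa) => // M.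
  exact: (tail_dominates_ln svL hbeta tailE koo small).
apply: (random_index (fun n => A0 * ln n%:R)).
apply: (ae_beta_hat_cvg hX mA atom harris hbeta hreg Aa).
  have /andP[A0_gt0 _] := A01.
  exact: (cvg_comp _ _ (@cvg_ln_natr_pinfty R) (gt0_cvgMry A0_gt0 cvg_id)).
apply: (tail_dominates_ln_power svL hbeta tailE) => //.
exact: (tail_nonincreasing hX mA).
Qed.
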